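(* Let $a\in[0,1)$ and $\alpha\in[0,2\pi)$. Let $f=h+\overline{g}$ be the harmonic right half-plane mapping on $\mathbb{D}$, with $h,g$ analytic and $h(0)=g(0)=0$, given by $$h(z)+g(z)=\frac{z}{1-z}$$ with dilatation $\omega(z)=\frac{g'(z)}{h'(z)}=\frac{a-z^2}{1-az^2}$. Let $f_{a,\alpha}=h_{a,\alpha}+\overline{g_{a,\alpha}}$, where $$h_{a,\alpha}(z)=\frac{\frac{z}{1+a}-\frac12 e^{i\alpha}z^2}{(1-e^{i\alpha}z)^2},\qquad g_{a,\alpha}(z)=\frac{\frac{a e^{2i\alpha}z}{1+a}-\frac12 e^{3i\alpha}z^2}{(1-e^{i\alpha}z)^2}.$$ Then $f_{a,\alpha}*f\in\mathcal{S}_H^0$, and $f_{a,\alpha}*f$ is convex in the direction $-\alpha$.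
   Context: $\mathbb{D}=\{z\in\mathbb{C}:|z|<1\}$. A complex-valued harmonic function on $\mathbb{D}$ is written $f=h+\overline{g}$ with $h,g$ analytic on $\mathbb{D}$; its dilatation is $\omega=g'/h'$. $\mathcal{S}_H^0$ is the class of harmonic, sense-preserving, univalent (injective) mappings $f$ on $\mathbb{D}$ with $f(0)=0$, $f_z(0)=1$ and $f_{\bar z}(0)=0$. For analytic $\phi(z)=\sum_{k\ge1}a_kz^k$ and $\psi(z)=\sum_{k\ge1}b_kz^k$ on $\mathbb{D}$, $(\phi*\psi)(z)=\sum_{k\ge1}a_kb_kz^k$; for harmonic $f=h+\overline{g}$ and $F=H+\overline{G}$ (with $h,g,H,G$ vanishing at $0$), $f*F=h*H+\overline{g*G}$. For $\theta\in\mathbb{R}$, a domain is convex in the direction $\theta$ if its intersection with every line parallel to the line through $0$ and $e^{i\theta}$ is connected or empty; a univalent mapping of $\mathbb{D}$ is convex in the direction $\theta$ if its image is.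
   Formalization: For 0<a<1 the convolution F has F_z(0)=1/(1+a)^2, not 1, so it is not literally in S_H^0; proved instead: F is harmonic, sense-preserving, univalent with F(0)=0, its affine normalization is in S_H^0, and F itself is when a=0. *)

(* Defs.v *)
From Stdlib Require Import Reals ClassicalEpsilon.
From Coquelicot Require Import Coquelicot.

Open Scope R_scope.
Open Scope C_scope.

Definition in_disk (z : C) : Prop := (Cmod z < 1)%R.

(* exp (i theta) for real theta *)
Definition cis (theta : R) : C := (cos theta, sin theta).

Definition analytic_on_disk (f : C -> C) : Prop :=
  forall z : C, in_disk z -> ex_derive (K := C_AbsRing) (V := C_NormedModule) f z.

(* [C_derive] is a total function, meaningful where the complex derivative
   exists; the dilatation is only a value when h' does not vanish. *)
Definition has_dilatation (h g omega : C -> C) : Prop :=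
  forall z : C, in_disk z ->
    C_derive h z <> 0 /\ C_derive g z / C_derive h z = omega z.

(* Derivative of f at z, as a function of two real variables, along v. *)
Definition dir_derive (f : C -> C) (z v : C) : C :=
  (Derive (fun t : R => Re (f (z + RtoC t * v))) 0%R,
   Derive (fun t : R => Im (f (z + RtoC t * v))) 0%R).

(* The Wirtinger derivatives f_z and f_{\bar z}. *)
Definition d_z (f : C -> C) (z : C) : C :=
  (dir_derive f z 1 - Ci * dir_derive f z Ci) / 2.
Definition d_zbar (f : C -> C) (z : C) : C :=
  (dir_derive f z 1 + Ci * dir_derive f z Ci) / 2.

Definition harmonic_on_disk (f : C -> C) : Prop :=
  exists h g : C -> C,
    analytic_on_disk h /\ analytic_on_disk g /\
    forall z : C, in_disk z -> f z = h z + Cconj (g z).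

(* |f_z|^2 - |f_{\bar z}|^2 is the Jacobian determinant of f. *)
Definition sense_preserving (f : C -> C) : Prop :=
  forall z : C, in_disk z ->
    (0 < Cmod (d_z f z) ^ 2 - Cmod (d_zbar f z) ^ 2)%R.

Definition univalent (f : C -> C) : Prop :=
  forall z w : C, in_disk z -> in_disk w -> f z = f w -> z = w.

(* The conditions of S_H^0 other than the two on the derivatives at 0. *)
Definition univalent_harmonic (f : C -> C) : Prop :=
  harmonic_on_disk f /\ sense_preserving f /\ univalent f /\ f 0 = 0.

Definition in_SH0 (f : C -> C) : Prop :=
  univalent_harmonic f /\ d_z f 0 = 1 /\ d_zbar f 0 = 0.

(* The real-linear change of variable in the image which turns the
   differential A z + B \bar z of f at 0 into the identity; it is the identity
   when A = 1 and B = 0. *)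
Definition SH0_normalization (f : C -> C) (z : C) : C :=
  let A := d_z f 0 in
  let B := d_zbar f 0 in
  (Cconj A * f z - B * Cconj (f z)) / RtoC (Cmod A ^ 2 - Cmod B ^ 2)%R.

(* The coefficients of the power series of f at 0; they are determined by the
   specification whenever f is analytic on the disk. *)
Definition coefs (f : C -> C) : nat -> C :=
  epsilon (inhabits (fun _ : nat => RtoC 0))
    (fun a : nat -> C =>
       forall z : C, in_disk z ->
         is_pseries (K := C_AbsRing) (V := C_NormedModule) a z (f z)).

Definition C_series (u : nat -> C) : C :=
  (Series (fun k => Re (u k)), Series (fun k => Im (u k))).

(* For functions vanishing at 0 the term of index 0 is zero. *)
Definition hadamard (phi psi : C -> C) (z : C) : C :=
  C_series (fun k : nat => coefs phi k * coefs psi k * Cpow z k).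

(* (h + \bar g) * (H + \bar G), for h, g, H, G vanishing at 0 *)
Definition harmonic_convolution (h g H G : C -> C) (z : C) : C :=
  hadamard h H z + Cconj (hadamard g G z).

Definition connected (S : C -> Prop) : Prop :=
  forall U V : C -> Prop,
    open (T := C_UniformSpace) U -> open (T := C_UniformSpace) V ->
    (forall w, S w -> U w \/ V w) ->
    (forall w, S w -> ~ (U w /\ V w)) ->
    (exists w, S w /\ U w) -> (exists w, S w /\ V w) -> False.

Definition on_line (p : C) (theta : R) (w : C) : Prop :=
  exists t : R, w = p + RtoC t * cis theta.

(* The empty set is connected in the sense of [connected]. *)
Definition set_convex_in_direction (theta : R) (Omega : C -> Prop) : Prop :=
  forall p : C, connected (fun w => Omega w /\ on_line p theta w).

Definition image_of_disk (f : C -> C) (w : C) : Prop :=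
  exists z : C, in_disk z /\ w = f z.

Definition convex_in_direction (theta : R) (f : C -> C) : Prop :=
  univalent f /\ set_convex_in_direction theta (image_of_disk f).

Definition h_slanted (a alpha : R) (z : C) : C :=
  (z / RtoC (1 + a)%R - / 2 * cis alpha * Cpow z 2)
    / Cpow (1 - cis alpha * z) 2.

Definition g_slanted (a alpha : R) (z : C) : C :=
  (RtoC a * cis (2 * alpha)%R * z / RtoC (1 + a)%R
     - / 2 * cis (3 * alpha)%R * Cpow z 2)
    / Cpow (1 - cis alpha * z) 2.

(* Main.v *)
(* With e = cis alpha, c = (1 - a) / (1 + a) and w = e z, comparing Taylor
   coefficients gives F z = conj e * (H w + conj (G w)), where
   H = (h + c w h') / 2 and G = (g - c w g') / 2.  In the half-plane variable
   s = (1 + w) / (1 - w) = x + i y,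
     4 (H + G) + 1 = s + (c^2 / 4) (s^3 - 1 / s)
   and the imaginary part of H - G is (c / 16) (6 x y + 2 atan (y / x)).
   So the horizontal slices of the image are the images of the level curves of
   the latter function, which the slope y / x parametrizes explicitly; the real
   part of H + G is strictly monotone along each of them.  This gives at once
   injectivity and the connectedness of the slices, in place of the
   Clunie--Sheil-Small shear theorem.  Up to sign, the derivative that
   proves the monotonicity is a positive multiple of the Jacobian. *)
Require Import Defs.
From Stdlib Require Import Reals Lra Lia ClassicalEpsilon.
From Coquelicot Require Import Coquelicot.

Open Scope R_scope.
Open Scope C_scope.

(** * Complex derivatives *)

(** [coefs] selects coefficients by choice, so nothing is known about the convolution until
    expansions of both factors on the whole disk are exhibited. The hypotheses make h' and g'
    explicit rational functions. Their series come from partial fractions, and integration along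
    radii turns these into series of h and g. The slanted factors combine w / (1 - w) and w / (1 -
    w)^2, whose coefficients are 1 and n. Hadamard multiplication by them is the identity and w d/dw
    respectively, which is the origin of the terms h and c w h'. The obstacle is the sign of the
    Jacobian. With k = c^2 / 4, the bound c <= 1 gives k <= 1/4, and 1/4 is exactly the largest k
    for which the Jacobian stays nonnegative on the whole half-plane: at k = 1/4 its factor tends to
    0 at a boundary point, the double root t = 3 with t = 1 / |s|^2. The estimate therefore has no
    slack when a = 0. *)

Definition is_Cderive (f : C -> C) (z l : C) : Prop :=
  is_derive (K := C_AbsRing) (V := C_NormedModule) f z l.

Lemma is_Cderive_eq (f : C -> C) (z l l' : C) :
  is_Cderive f z l -> l = l' -> is_Cderive f z l'.
Proof. now intros H <-. Qed.

Lemma is_Cderive_epsilon (f : C -> C) (z l : C) :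
  is_Cderive f z l <->
  forall eps : R, (0 < eps)%R -> exists delta : R, (0 < delta)%R /\
    forall w : C, (Cmod (w - z) < delta)%R ->
      (Cmod (f w - f z - (w - z) * l) <= eps * Cmod (w - z))%R.
Proof.
split.
- intros [_ H] eps heps.
  destruct (H z (fun P HP => HP) (mkposreal eps heps)) as [d Hd].
  exists d; split; [apply cond_pos|].
  intros w hw. exact (Hd w hw).
- intros H; split; [exact (is_linear_scal_l l)|].
  intros x hx eps.
  assert (Hx : z = x) by exact (is_filter_lim_locally_unique (V := AbsRing_NormedModule C_AbsRing) z x hx).
  subst x. destruct (H eps (cond_pos eps)) as [d [hd Hd]].
  exists (mkposreal d hd). intros w hw. exact (Hd w hw).
Qed.

(* [C_NormedModule] carries the product uniform structure on [R * R], which is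
   not convertible to the one coming from [Cmod]. *)
Lemma is_Cderive_AbsRing (f : C -> C) (z l : C) :
  is_Cderive f z l <->
  is_derive (K := C_AbsRing) (V := AbsRing_NormedModule C_AbsRing) f z l.
Proof.
split; intros [_ H]; (split; [apply is_linear_scal_l|]);
  intros x hx; exact (H x hx).
Qed.

Lemma is_Cderive_mult (f g : C -> C) (z l m : C) :
  is_Cderive f z l -> is_Cderive g z m ->
  is_Cderive (fun w => f w * g w) z (l * g z + f z * m).
Proof.
rewrite !is_Cderive_AbsRing. intros Hf Hg.
exact (is_derive_mult (K := C_AbsRing) f g z l m Hf Hg Cmult_comm).
Qed.

Lemma is_Cderive_comp (f g : C -> C) (z l m : C) :
  is_Cderive f (g z) l -> is_Cderive g z m ->
  is_Cderive (fun w => f (g w)) z (m * l).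
Proof.
rewrite (is_Cderive_AbsRing g).
exact (is_derive_comp (K := C_AbsRing) (V := C_NormedModule) f g z l m).
Qed.

Lemma is_Cderive_plus (f g : C -> C) (z l m : C) :
  is_Cderive f z l -> is_Cderive g z m ->
  is_Cderive (fun w => f w + g w) z (l + m).
Proof. exact (is_derive_plus (K := C_AbsRing) (V := C_NormedModule) f g z l m). Qed.

Lemma is_Cderive_minus (f g : C -> C) (z l m : C) :
  is_Cderive f z l -> is_Cderive g z m ->
  is_Cderive (fun w => f w - g w) z (l - m).
Proof. exact (is_derive_minus (K := C_AbsRing) (V := C_NormedModule) f g z l m). Qed.

Lemma is_Cderive_const (c z : C) : is_Cderive (fun _ => c) z 0.
Proof. exact (is_derive_const (K := C_AbsRing) (V := C_NormedModule) c z). Qed.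

Lemma is_Cderive_id (z : C) : is_Cderive (fun w => w) z 1.
Proof. apply is_Cderive_AbsRing. exact (is_derive_id (K := C_AbsRing) z). Qed.

Lemma is_Cderive_scal (c : C) (f : C -> C) (z l : C) :
  is_Cderive f z l -> is_Cderive (fun w => c * f w) z (c * l).
Proof.
intros H. eapply is_Cderive_eq.
- exact (is_Cderive_mult _ _ _ _ _ (is_Cderive_const c z) H).
- cbv beta. ring.
Qed.

Lemma Cmod_minus_sym (z w : C) : Cmod (z - w) = Cmod (w - z).
Proof. rewrite <- Cmod_opp. f_equal. ring. Qed.

Lemma is_Cderive_inv (z : C) : z <> 0 -> is_Cderive (fun w => / w) z (- / (z * z)).
Proof.
intros hz. apply is_Cderive_epsilon. intros eps heps.
assert (hm : (0 < Cmod z)%R) by now apply Cmod_gt_0.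
set (m := Cmod z) in *.
(* The error is (w - z)^2 / (w z^2). The radius m / 2 keeps |w| above m / 2, so the error divided by
   |w - z| is at most 2 |w - z| / m^3, which the second radius bounds by [eps]. *)
exists (Rmin (m / 2) (eps * (m * m * m) / 2)); split.
{ apply Rmin_pos; [lra|]. apply Rdiv_lt_0_compat; [|lra].
  repeat apply Rmult_lt_0_compat; assumption. }
intros w hw.
assert (hw1 := Rlt_le_trans _ _ _ hw (Rmin_l _ _)).
assert (hw2 := Rlt_le_trans _ _ _ hw (Rmin_r _ _)). clear hw.
assert (hwm : (m / 2 < Cmod w)%R).
{ assert (H := Cmod_triangle w (z - w)).
  replace (w + (z - w)) with z in H by ring.
  rewrite (Cmod_minus_sym z w) in H. fold m in H. lra. }
assert (hw0 : w <> 0) by (apply Cmod_gt_0; lra).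
replace (/ w - / z - (w - z) * - / (z * z)) with ((w - z) * ((w - z) / (w * (z * z))))
  by (field; now split).
rewrite Cmod_mult, Rmult_comm.
apply Rmult_le_compat_r; [apply Cmod_ge_0|].
assert (z * z <> 0) by (now apply Cmult_neq_0).
rewrite Cmod_div, !Cmod_mult by (now apply Cmult_neq_0). fold m.
assert (hmm : (0 < m * m)%R) by now apply Rmult_lt_0_compat.
apply Rle_div_l; [nra|].
assert (eps * (m * m) * (m / 2) <= eps * (m * m) * Cmod w)%R by
  (apply Rmult_le_compat_l; nra).
nra.
Qed.

Lemma is_Cderive_div (f g : C -> C) (z l m : C) :
  g z <> 0 -> is_Cderive f z l -> is_Cderive g z m ->
  is_Cderive (fun w => f w / g w) z ((l * g z - f z * m) / (g z * g z)).
Proof.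
intros hg Hf Hg. eapply is_Cderive_eq.
- exact (is_Cderive_mult f (fun w => / g w) z _ _ Hf
    (is_Cderive_comp Cinv g z _ _ (is_Cderive_inv _ hg) Hg)).
- cbv beta. field. exact hg.
Qed.

Lemma disk_open (z : C) : in_disk z ->
  exists delta : R, (0 < delta)%R /\
    forall w : C, (Cmod (w - z) < delta)%R -> in_disk w.
Proof.
unfold in_disk. intros hz. exists (1 - Cmod z)%R; split; [lra|].
intros w hw. assert (H := Cmod_triangle z (w - z)).
replace (z + (w - z)) with w in H by ring. lra.
Qed.

Lemma is_Cderive_ext_disk (f g : C -> C) (z l : C) :
  in_disk z -> (forall w, in_disk w -> f w = g w) ->
  is_Cderive f z l -> is_Cderive g z l.
Proof.
intros hz Hfg Hf. apply is_Cderive_epsilon. intros eps heps.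
destruct (proj1 (is_Cderive_epsilon f z l) Hf eps heps) as [d [hd Hd]].
destruct (disk_open z hz) as [d' [hd' Hd']].
exists (Rmin d d'); split; [now apply Rmin_pos|]. intros w hw.
rewrite <- !Hfg; [apply Hd| |]; trivial.
- exact (Rlt_le_trans _ _ _ hw (Rmin_l _ _)).
- apply Hd'. exact (Rlt_le_trans _ _ _ hw (Rmin_r _ _)).
Qed.

Lemma is_derive_of_epsilon (f : R -> R) (x l : R) :
  (forall eps : R, (0 < eps)%R -> exists delta : R, (0 < delta)%R /\
    forall y : R, (Rabs (y - x) < delta)%R ->
      (Rabs (f y - f x - (y - x) * l) <= eps * Rabs (y - x))%R) ->
  is_derive f x l.
Proof.
intros H; split; [exact (is_linear_scal_l l)|].
intros u hu eps.
assert (Hu : x = u) by exact (is_filter_lim_locally_unique x u hu).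
subst u. destruct (H eps (cond_pos eps)) as [d [hd Hd]].
exists (mkposreal d hd). intros w hw. exact (Hd w hw).
Qed.

Lemma im_le_Cmod (c : C) : (Rabs (Im c) <= Cmod c)%R.
Proof. eapply Rle_trans; [apply Rmax_r | apply Rmax_Cmod]. Qed.

Lemma is_Cderive_line_epsilon (f : C -> C) (z v l : C) (t : R) :
  is_Cderive f (z + t * v) l ->
  forall eps : R, (0 < eps)%R -> exists delta : R, (0 < delta)%R /\
    forall s : R, (Rabs (s - t) < delta)%R ->
      (Cmod (f (z + s * v)%C - f (z + t * v)%C - (s - t)%R * (l * v)%C)
         <= eps * Rabs (s - t))%R.
Proof.
intros Hf eps heps.
assert (hv := Cmod_ge_0 v).
(* Dividing by [Cmod v + 1] instead of [Cmod v] covers v = 0 as well. *)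
destruct (proj1 (is_Cderive_epsilon _ _ _) Hf (eps / (Cmod v + 1))%R) as [d [hd Hd]].
{ apply Rdiv_lt_0_compat; lra. }
exists (d / (Cmod v + 1))%R; split; [apply Rdiv_lt_0_compat; lra|].
intros s hs.
assert (E : (z + s * v - (z + t * v) = RtoC (s - t) * v)%C) by (rewrite RtoC_minus; ring).
assert (Em : Cmod (z + s * v - (z + t * v)) = (Rabs (s - t) * Cmod v)%R).
{ rewrite E, Cmod_mult, Cmod_R. reflexivity. }
assert (ha := Rabs_pos (s - t)).
assert (hdv : (Rabs (s - t) * (Cmod v + 1) < d)%R) by (apply Rlt_div_r; lra).
specialize (Hd (z + s * v)). rewrite Em, E in Hd.
replace (RtoC (s - t) * (l * v)) with (RtoC (s - t) * v * l) by ring.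
eapply Rle_trans; [apply Hd; nra|].
unfold Rdiv. rewrite Rmult_assoc. apply Rmult_le_compat_l; [lra|].
rewrite Rmult_comm. apply Rle_div_l; nra.
Qed.

Lemma is_Cderive_line_Re (f : C -> C) (z v l : C) (t : R) :
  is_Cderive f (z + t * v) l ->
  is_derive (fun s : R => Re (f (z + RtoC s * v))) t (Re (l * v)).
Proof.
intros Hf. apply is_derive_of_epsilon. intros eps heps.
destruct (is_Cderive_line_epsilon _ _ _ _ _ Hf eps heps) as [d [hd Hd]].
exists d; split; [exact hd|]. intros s hs.
eapply Rle_trans; [|exact (Hd s hs)].
eapply Rle_trans; [|apply re_le_Cmod].
apply Req_le. f_equal.
generalize (f (z + s * v)) (f (z + t * v)) (l * v). intros p q r.
unfold Re, Im. simpl. ring.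
Qed.

Lemma is_Cderive_line_Im (f : C -> C) (z v l : C) (t : R) :
  is_Cderive f (z + t * v) l ->
  is_derive (fun s : R => Im (f (z + RtoC s * v))) t (Im (l * v)).
Proof.
intros Hf. apply is_derive_of_epsilon. intros eps heps.
destruct (is_Cderive_line_epsilon _ _ _ _ _ Hf eps heps) as [d [hd Hd]].
exists d; split; [exact hd|]. intros s hs.
eapply Rle_trans; [|exact (Hd s hs)].
eapply Rle_trans; [|apply im_le_Cmod].
apply Req_le. f_equal.
generalize (f (z + s * v)) (f (z + t * v)) (l * v). intros p q r.
unfold Re, Im. simpl. ring.
Qed.

(** * Complex power series *)

Definition is_Cpseries (a : nat -> C) (z l : C) : Prop :=
  is_pseries (K := C_AbsRing) (V := C_NormedModule) a z l.

Lemma pow_n_Cpow (z : C) (n : nat) : pow_n (K := C_AbsRing) z n = Cpow z n.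
Proof. induction n as [|n IH]; [reflexivity|]. simpl. now rewrite IH. Qed.

Lemma sum_n_C (u : nat -> C) (n : nat) :
  sum_n (G := C_NormedModule) u n
  = (sum_n (fun k => Re (u k)) n, sum_n (fun k => Im (u k)) n).
Proof.
induction n as [|n IH].
- rewrite !sum_O. apply surjective_pairing.
- rewrite !sum_Sn, IH. reflexivity.
Qed.

Lemma is_series_C (u : nat -> C) (l : C) :
  is_series (K := C_AbsRing) (V := C_NormedModule) u l <->
  is_series (fun k => Re (u k)) (Re l) /\ is_series (fun k => Im (u k)) (Im l).
Proof.
split.
- intros H. assert (H' := proj1 (filterlim_locally (U := C_NormedModule) _ _) H).
  split; apply (filterlim_locally (U := R_UniformSpace)); intros eps;
    generalize (H' eps); apply filter_imp;
    intros n; rewrite sum_n_C; intros [H1 H2]; assumption.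
- intros [H1 H2].
  apply (filterlim_locally (U := C_NormedModule)). intros eps.
  generalize (filter_and _ _ (proj1 (filterlim_locally _ _) H1 eps)
    (proj1 (filterlim_locally _ _) H2 eps)).
  apply filter_imp. intros n [B1 B2]. rewrite sum_n_C. now split.
Qed.

Lemma is_Cpseries_series (a : nat -> C) (z l : C) :
  is_Cpseries a z l <->
  is_series (K := C_AbsRing) (V := C_NormedModule) (fun k => a k * Cpow z k) l.
Proof.
unfold is_Cpseries, is_pseries.
assert (E : forall k, scal (K := C_AbsRing) (V := C_NormedModule)
   (pow_n (K := C_AbsRing) z k) (a k) = a k * Cpow z k).
{ intros k. rewrite pow_n_Cpow. apply Cmult_comm. }
split; apply is_series_ext; intros k; rewrite E; reflexivity.
Qed.

Lemma C_series_is_series (u : nat -> C) (l : C) :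
  is_series (K := C_AbsRing) (V := C_NormedModule) u l -> C_series u = l.
Proof.
intros [H1 H2]%is_series_C. unfold C_series.
rewrite (is_series_unique _ _ H1), (is_series_unique _ _ H2).
symmetry. apply surjective_pairing.
Qed.

(** The bound is the coefficient growth of 1 / (1 - z)^3, the highest pole in the partial fractions
    of [dh]. It is stable under linear combinations and ensures absolute convergence on the whole
    disk. *)
Definition quadratic_growth (a : nat -> C) : Prop :=
  exists M : R, (0 <= M)%R /\
    forall n : nat, (Cmod (a n) <= M * (INR (S n) * INR (S (S n))))%R.

Lemma CV_radius_one : CV_radius (fun _ => 1%R) = 1%R.
Proof.
rewrite <- Rinv_1. apply CV_radius_finite_DAlembert; [intros; lra | lra|].
apply is_lim_seq_ext with (fun _ : nat => 1%R); [|apply is_lim_seq_const].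
intros n. cbv beta. rewrite Rabs_pos_eq; lra.
Qed.

(** This is the second derivative of the geometric series, and differentiation keeps the radius of
    convergence. *)
Lemma quadratic_series (r : R) : (0 <= r < 1)%R ->
  ex_series (fun n => (INR (S n) * INR (S (S n)) * r ^ n)%R).
Proof.
intros hr.
assert (H : ex_series (fun n => Rabs
  (PS_derive (PS_derive (fun _ : nat => 1%R)) n * r ^ n))).
{ apply CV_disk_inside. rewrite !CV_radius_derive, CV_radius_one.
  simpl. rewrite Rabs_pos_eq; lra. }
revert H. apply ex_series_ext. intros n. unfold PS_derive.
rewrite Rmult_1_r. apply Rabs_pos_eq.
repeat apply Rmult_le_pos; try apply pos_INR. now apply pow_le.
Qed.

Lemma quadratic_growth_le (a : nat -> C) (r : R) : (0 <= r < 1)%R ->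
  quadratic_growth a -> ex_series (fun n => (Cmod (a n) * r ^ n)%R).
Proof.
intros hr [M [hM H]].
apply (ex_series_le (V := R_CompleteNormedModule) _
  (fun n => (M * (INR (S n) * INR (S (S n)) * r ^ n))%R)).
- intros n. simpl. change (norm ?x) with (Rabs x).
  assert (hp : (0 <= r ^ n)%R) by now apply pow_le.
  rewrite Rabs_pos_eq by (apply Rmult_le_pos; [apply Cmod_ge_0 | exact hp]).
  rewrite <- Rmult_assoc. apply Rmult_le_compat_r; [exact hp | apply H].
- exact (ex_series_scal (V := R_NormedModule) M _ (quadratic_series r hr)).
Qed.

Lemma quadratic_growth_ex_Cpseries (a : nat -> C) (z : C) :
  in_disk z -> quadratic_growth a -> exists l, is_Cpseries a z l.
Proof.
intros hz ha.
assert (hr : (0 <= Cmod z < 1)%R) by (split; [apply Cmod_ge_0 | exact hz]).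
assert (H := quadratic_growth_le a (Cmod z) hr ha).
destruct (ex_series_le (V := R_CompleteNormedModule)
  (fun n => Re (a n * Cpow z n)) _
  (fun n => Rle_trans _ _ _ (re_le_Cmod (a n * Cpow z n))
     (Req_le _ _ (eq_trans (Cmod_mult _ _) (f_equal _ (Cmod_pow z n))))) H) as [l1 H1].
destruct (ex_series_le (V := R_CompleteNormedModule)
  (fun n => Im (a n * Cpow z n)) _
  (fun n => Rle_trans _ _ _ (im_le_Cmod (a n * Cpow z n))
     (Req_le _ _ (eq_trans (Cmod_mult _ _) (f_equal _ (Cmod_pow z n))))) H) as [l2 H2].
exists (l1, l2). apply is_Cpseries_series, is_series_C. now split.
Qed.

Lemma is_Cpseries_unique (a : nat -> C) (z l m : C) :
  is_Cpseries a z l -> is_Cpseries a z m -> l = m.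
Proof.
intros H%is_Cpseries_series%C_series_is_series
  H'%is_Cpseries_series%C_series_is_series. congruence.
Qed.

Lemma is_Cpseries_ext (a b : nat -> C) (z l : C) :
  (forall n, a n = b n) -> is_Cpseries a z l -> is_Cpseries b z l.
Proof. exact (is_pseries_ext (K := C_AbsRing) (V := C_NormedModule) a b z l). Qed.

Lemma is_Cpseries_plus (a b : nat -> C) (z l m : C) :
  is_Cpseries a z l -> is_Cpseries b z m ->
  is_Cpseries (fun n => a n + b n) z (l + m).
Proof. exact (is_pseries_plus (K := C_AbsRing) (V := C_NormedModule) a b z l m). Qed.

Lemma is_Cpseries_scal (c : C) (a : nat -> C) (z l : C) :
  is_Cpseries a z l -> is_Cpseries (fun n => c * a n) z (c * l).
Proof.
exact (is_pseries_scal (K := C_AbsRing) (V := C_NormedModule) c a z l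
  (Cmult_comm z c)).
Qed.

Lemma is_Cpseries_shift (a : nat -> C) (z l : C) :
  is_Cpseries a z l ->
  is_Cpseries (fun n => match n with O => 0 | S k => a k end) z (z * l).
Proof. exact (is_pseries_incr_1 (K := C_AbsRing) (V := C_NormedModule) a z l). Qed.

(** The growth bound gives [s] some sum B, and the recurrence says that (1 - eps z) B = l. Poles can
    thus be built up one factor at a time, without Cauchy products. *)
Lemma is_Cpseries_div (eps : C) (a s : nat -> C) (z l : C) :
  in_disk z -> quadratic_growth s -> 1 - eps * z <> 0 ->
  s O = a O -> (forall n, s (S n) = a (S n) + eps * s n) ->
  is_Cpseries a z l -> is_Cpseries s z (l / (1 - eps * z)).
Proof.
intros hz hs hne h0 hS Ha.
destruct (quadratic_growth_ex_Cpseries s z hz hs) as [B HB].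
assert (E : l = B + (- eps) * (z * B)).
{ apply (is_Cpseries_unique a z); [exact Ha|].
  eapply is_Cpseries_ext; [|exact (is_Cpseries_plus _ _ _ _ _ HB
    (is_Cpseries_scal (- eps) _ _ _ (is_Cpseries_shift _ _ _ HB)))].
  intros [|n]; simpl; [rewrite h0 | rewrite hS]; ring. }
replace (l / (1 - eps * z)) with B; [exact HB|].
rewrite E. field. exact hne.
Qed.

Lemma is_Cpseries_real (a : nat -> C) (x : R) (l : C) :
  is_Cpseries a x l ->
  is_pseries (fun n => Re (a n)) x (Re l) /\ is_pseries (fun n => Im (a n)) x (Im l).
Proof.
intros [H1 H2]%is_Cpseries_series%is_series_C. split.
- refine (is_series_ext (V := R_NormedModule) _ _ _ _ H1). intros n.
  cbv beta. rewrite <- RtoC_pow.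
  replace (pow_n (K := R_AbsRing) x n) with (x ^ n)%R by (symmetry; apply pow_n_pow). unfold Re, scal; simpl. unfold mult; simpl. ring.
- refine (is_series_ext (V := R_NormedModule) _ _ _ _ H2). intros n.
  cbv beta. rewrite <- RtoC_pow.
  replace (pow_n (K := R_AbsRing) x n) with (x ^ n)%R by (symmetry; apply pow_n_pow). unfold Im, scal; simpl. unfold mult; simpl. ring.
Qed.

(** * Uniqueness of the coefficients *)

Lemma pseries_coef_unique (a b : nat -> R) (f : R -> R) :
  (forall x : R, (Rabs x < 1)%R -> is_pseries a x (f x)) ->
  (forall x : R, (Rabs x < 1)%R -> is_pseries b x (f x)) ->
  forall n, a n = b n.
Proof.
assert (radius : forall c : nat -> R,
  (forall x : R, (Rabs x < 1)%R -> is_pseries c x (f x)) ->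
  Rbar_lt 0 (CV_radius c)).
{ intros c Hc. apply Rbar_not_le_lt. intros Hle.
  (* If the radius were not positive, 1/2 would lie strictly outside it and the terms there could
     not tend to 0, although the series converges at 1/2. *)
  assert (h : (Rabs (/ 2) < 1)%R) by (rewrite Rabs_pos_eq; lra).
  assert (h4 : (Rabs (/ 4) < 1)%R) by (rewrite Rabs_pos_eq; lra).
  apply (CV_disk_outside c (/ 2)).
  - apply Rbar_le_lt_trans with 0%R; [exact Hle|].
    simpl. rewrite Rabs_pos_eq; lra.
  - assert (Hs := ex_series_lim_0 _ (ex_intro _ _ (Hc _ h))).
    revert Hs. apply is_lim_seq_ext. intros n. rewrite pow_n_pow.
    apply Rmult_comm. }
intros Ha Hb n. apply PSeries_ext_recip; [now apply radius | now apply radius|].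
exists (mkposreal 1 Rlt_0_1). intros x hx.
change (Rabs (x - 0) < 1)%R in hx. rewrite Rminus_0_r in hx.
rewrite (is_pseries_unique _ _ _ (Ha x hx)).
symmetry. exact (is_pseries_unique _ _ _ (Hb x hx)).
Qed.

Lemma in_disk_RtoC (x : R) : (Rabs x < 1)%R -> in_disk x.
Proof. unfold in_disk. now rewrite Cmod_R. Qed.

(** The values on the real diameter already determine the coefficients, so the claim splits into two
    statements about real power series. The given expansion [a] is also what makes the choice in
    [coefs] meaningful. *)
Lemma coefs_unique (f : C -> C) (a : nat -> C) :
  (forall z, in_disk z -> is_Cpseries a z (f z)) -> forall n, coefs f n = a n.
Proof.
intros Ha n.
assert (Hc : forall z, in_disk z -> is_Cpseries (coefs f) z (f z)).
{ exact (epsilon_spec (inhabits (fun _ : nat => RtoC 0)) (fun a : nat -> C =>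
    forall z, in_disk z -> is_Cpseries a z (f z)) (ex_intro _ a Ha)). }
apply injective_projections.
- apply (pseries_coef_unique (fun k => Re (coefs f k)) (fun k => Re (a k))
    (fun x => Re (f x))); intros x hx%in_disk_RtoC;
  [exact (proj1 (is_Cpseries_real _ _ _ (Hc _ hx)))
  |exact (proj1 (is_Cpseries_real _ _ _ (Ha _ hx)))].
- apply (pseries_coef_unique (fun k => Im (coefs f k)) (fun k => Im (a k))
    (fun x => Im (f x))); intros x hx%in_disk_RtoC;
  [exact (proj2 (is_Cpseries_real _ _ _ (Hc _ hx)))
  |exact (proj2 (is_Cpseries_real _ _ _ (Ha _ hx)))].
Qed.

(** * Term-by-term integration along radii *)

Lemma is_series_PS_Int (phi : R -> R) (b : nat -> R) :
  Rbar_lt 1%R (CV_radius b) -> phi 0%R = 0%R ->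
  (forall t : R, (0 <= t <= 1)%R -> is_derive phi t (PSeries b t)) ->
  is_series (PS_Int b) (phi 1%R).
Proof.
intros hcv h0 hd.
assert (hin : forall t : R, (0 <= t <= 1)%R ->
  Rbar_lt (Rabs t) (CV_radius (PS_Int b))).
{ intros t ht. rewrite CV_radius_Int. apply Rbar_le_lt_trans with 1%R; [|exact hcv].
  simpl. rewrite Rabs_pos_eq; lra. }
(* The difference has derivative zero on all of [0, 1]; the endpoint 1 is included because the
   radius exceeds 1 strictly. *)
assert (E : (phi 0 - PSeries (PS_Int b) 0 = phi 1 - PSeries (PS_Int b) 1)%R).
{ apply (eq_is_derive (V := R_NormedModule)
    (fun t => (phi t - PSeries (PS_Int b) t)%R)); [|lra].
  intros t ht.
  replace (@zero R_NormedModule)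
    with (minus (G := R_NormedModule) (PSeries b t) (PSeries (PS_derive (PS_Int b)) t)).
  - apply (is_derive_minus (V := R_NormedModule)); [now apply hd|].
    now apply is_derive_PSeries, hin.
  - rewrite (PSeries_ext (PS_derive (PS_Int b)) b).
    + exact (minus_eq_zero (G := R_NormedModule) _).
    + intros n. unfold PS_derive, PS_Int.
      change (INR (S n) * (b n / INR (S n)) = b n)%R. field. apply not_0_INR. lia. }
rewrite h0, PSeries_0 in E.
replace (phi 1%R) with (PSeries (PS_Int b) 1) by (unfold PS_Int in *; lra).
assert (Hs := PSeries_correct _ _ (CV_radius_inside _ _ (hin 1%R ltac:(lra)))).
refine (is_series_ext (V := R_NormedModule) _ _ _ _ Hs).
intros n. rewrite pow_n_pow, pow1. apply Rmult_1_l.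
Qed.

Lemma CV_radius_Cpseries (b : nat -> C) (z : C) :
  quadratic_growth b -> in_disk z ->
  Rbar_lt 1%R (CV_radius (fun n => Re (b n * Cpow z (S n)))).
Proof.
intros hb hz. unfold in_disk in hz. assert (hr := Cmod_ge_0 z).
set (r := Cmod z) in *.
(* A radius [rho] > 1 with r rho < 1 is wanted, also when r = 0. The terms at [rho] are then
   dominated by |b n| (r rho)^n. *)
assert (h1 : (1 < 2 / (1 + r))%R) by (apply Rlt_div_r; lra).
set (rho := (2 / (1 + r))%R) in *.
assert (h2 : (0 <= r * rho < 1)%R).
{ split; [apply Rmult_le_pos; lra|].
  unfold rho, Rdiv. rewrite <- Rmult_assoc. apply Rlt_div_l; lra. }
apply Rbar_lt_le_trans with rho; [exact h1|].
apply Rbar_not_lt_le. intros hlt.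
apply (CV_disk_outside (fun n => Re (b n * Cpow z (S n))) rho).
{ rewrite Rabs_pos_eq by lra. exact hlt. }
apply ex_series_lim_0.
refine (ex_series_le (V := R_CompleteNormedModule) _ _ _
  (quadratic_growth_le b _ h2 hb)).
intros n. change (norm ?x) with (Rabs x).
rewrite Rabs_mult, (Rabs_pos_eq (rho ^ n)) by (apply pow_le; lra).
rewrite Rpow_mult_distr, <- Rmult_assoc.
apply Rmult_le_compat_r; [apply pow_le; lra|].
eapply Rle_trans; [apply re_le_Cmod|].
rewrite Cmod_mult, Cmod_pow. fold r.
apply Rmult_le_compat_l; [apply Cmod_ge_0|]. simpl.
assert (0 <= r ^ n)%R by now apply pow_le. nra.
Qed.

Lemma in_disk_scal (t : R) (z : C) :
  (0 <= t <= 1)%R -> in_disk z -> in_disk (0 + t * z).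
Proof.
unfold in_disk. intros ht hz.
rewrite Cplus_0_l, Cmod_mult, Cmod_R, Rabs_pos_eq by lra.
assert (h := Cmod_ge_0 z). nra.
Qed.

Definition integrated (b : nat -> C) (n : nat) : C :=
  match n with O => 0 | S k => b k / INR (S k) end.

Lemma Re_div_INR (c : C) (n : nat) : Re (c / INR (S n)) = (Re c / INR (S n))%R.
Proof.
assert (h : INR (S n) <> 0%R) by (apply not_0_INR; lia).
unfold Cdiv, Rdiv. rewrite <- RtoC_inv by exact h.
generalize (/ INR (S n))%R. intros r. unfold Re. simpl. ring.
Qed.

(** The real function t -> Re (f (t z)) has derivative Re (z f' (t z)), a power series in t with
    coefficients Re (b n z^(n+1)). Integrating it from 0 to 1 gives the claim. *)
Lemma Re_is_series_integrated (f f' : C -> C) (b : nat -> C) :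
  f 0 = 0 -> quadratic_growth b ->
  (forall z, in_disk z -> is_Cderive f z (f' z)) ->
  (forall z, in_disk z -> is_Cpseries b z (f' z)) ->
  forall z, in_disk z ->
    is_series (fun n => Re (integrated b n * Cpow z n)) (Re (f z)).
Proof.
intros h0 hb hd hs z hz.
assert (H : is_series (PS_Int (fun n => Re (b n * Cpow z (S n))))
  (Re (f (0 + RtoC 1 * z)))).
{ apply (is_series_PS_Int (fun t => Re (f (0 + RtoC t * z)))).
  - now apply CV_radius_Cpseries.
  - rewrite Cmult_0_l, Cplus_0_l, h0. reflexivity.
  - intros t ht. assert (htz := in_disk_scal t z ht hz).
    replace (PSeries _ t) with (Re (f' (0 + t * z) * z)).
    + now apply is_Cderive_line_Re, hd.
    + symmetry. apply is_pseries_unique.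
      assert (Hz := is_Cpseries_scal z _ _ _ (hs _ htz)).
      apply is_Cpseries_series, is_series_C in Hz. destruct Hz as [Hz _].
      rewrite (Cmult_comm z) in Hz.
      refine (is_series_ext (V := R_NormedModule) _ _ _ _ Hz).
      intros n. cbv beta.
      replace (pow_n (K := R_AbsRing) t n) with (t ^ n)%R
        by (symmetry; apply pow_n_pow).
      replace (z * b n * Cpow (0 + t * z) n)
        with (RtoC (t ^ n) * (b n * Cpow z (S n))).
      * unfold Re, scal; simpl. unfold mult; simpl. ring.
      * rewrite Cplus_0_l, Cpow_mult_l, RtoC_pow. simpl. ring. }
rewrite Cmult_1_l, Cplus_0_l in H.
refine (is_series_ext (V := R_NormedModule) _ _ _ _ H).
intros [|n]; unfold integrated, PS_Int.
- rewrite Cmult_0_l. reflexivity.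
- rewrite <- Re_div_INR. f_equal. field. 
  intros E%RtoC_inj. revert E. apply not_0_INR. lia.
Qed.

Lemma quadratic_growth_scal (c : C) (a : nat -> C) :
  quadratic_growth a -> quadratic_growth (fun n => c * a n).
Proof.
intros [M [hM H]]. exists (Cmod c * M)%R. split.
- apply Rmult_le_pos; [apply Cmod_ge_0 | exact hM].
- intros n. rewrite Cmod_mult, Rmult_assoc.
  apply Rmult_le_compat_l; [apply Cmod_ge_0 | apply H].
Qed.

Lemma quadratic_growth_plus (a b : nat -> C) :
  quadratic_growth a -> quadratic_growth b ->
  quadratic_growth (fun n => a n + b n).
Proof.
intros [M [hM H]] [N [hN K]]. exists (M + N)%R. split; [lra|].
intros n. eapply Rle_trans; [apply Cmod_triangle|].
rewrite Rmult_plus_distr_r. now apply Rplus_le_compat.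
Qed.

Lemma Re_minus_Ci_mult (z : C) : Re (- Ci * z) = Im z.
Proof. unfold Re, Im. simpl. ring. Qed.

Lemma is_Cpseries_integrated (f f' : C -> C) (b : nat -> C) :
  f 0 = 0 -> quadratic_growth b ->
  (forall z, in_disk z -> is_Cderive f z (f' z)) ->
  (forall z, in_disk z -> is_Cpseries b z (f' z)) ->
  forall z, in_disk z -> is_Cpseries (integrated b) z (f z).
Proof.
intros h0 hb hd hs z hz. apply is_Cpseries_series, is_series_C. split.
- exact (Re_is_series_integrated f f' b h0 hb hd hs z hz).
(* The imaginary part of f is the real part of -i f, which satisfies the same hypotheses. *)
- assert (H := Re_is_series_integrated (fun w => - Ci * f w) (fun w => - Ci * f' w)
    (fun n => - Ci * b n)).
  specialize (H ltac:(cbv beta; rewrite h0; ring) (quadratic_growth_scal _ _ hb)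
    (fun w hw => is_Cderive_scal _ _ _ _ (hd w hw))
    (fun w hw => is_Cpseries_scal _ _ _ _ (hs w hw)) z hz).
  cbv beta in H. rewrite Re_minus_Ci_mult in H.
  refine (is_series_ext (V := R_NormedModule) _ _ _ _ H).
  intros n. rewrite <- Re_minus_Ci_mult. f_equal.
  destruct n as [|n]; unfold integrated; [|unfold Cdiv]; ring.
Qed.

(** * Expansions of the partial fractions *)

Lemma is_Cpseries_delta (z : C) :
  is_Cpseries (fun n => match n with O => 1 | S _ => 0 end) z 1.
Proof.
apply is_Cpseries_series.
refine (filterlim_ext (fun _ => RtoC 1) _ _ (filterlim_const _)).
intros n. induction n as [|n IH].
- rewrite sum_O. simpl. ring.
- rewrite sum_Sn, <- IH. change plus with Cplus. cbv beta iota. ring.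
Qed.

Lemma in_disk_neq (u z : C) : Cmod u = 1%R -> in_disk z -> 1 - u * z <> 0.
Proof.
unfold in_disk. intros hu hz E.
assert (H : Cmod (u * z) = 1%R).
{ replace (u * z) with (RtoC 1) by (rewrite <- (Cplus_0_r (u * z)), <- E; ring).
  apply Cmod_1. }
rewrite Cmod_mult, hu in H. lra.
Qed.

Lemma in_disk_minus_neq (z : C) : in_disk z -> 1 - z <> 0.
Proof.
intros hz. rewrite <- (Cmult_1_l z). apply in_disk_neq; [apply Cmod_1 | exact hz].
Qed.

Lemma in_disk_plus_neq (z : C) : in_disk z -> 1 + z <> 0.
Proof.
intros hz. replace (1 + z) with (1 - (- (1)) * z) by ring.
apply in_disk_neq; [apply Cmod_m1 | exact hz].
Qed.

Lemma quadratic_growth_RtoC (a : nat -> R) (M : R) :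
  (0 <= M)%R ->
  (forall n, (Rabs (a n) <= M * (INR (S n) * INR (S (S n))))%R) ->
  quadratic_growth (fun n => RtoC (a n)).
Proof.
intros hM H. exists M. split; [exact hM|]. intros n. rewrite Cmod_R. apply H.
Qed.

Lemma INR_S_mult_ge_1 (n : nat) : (1 <= INR (S n) * INR (S (S n)))%R.
Proof. rewrite !S_INR. assert (h := pos_INR n). nra. Qed.

Lemma quadratic_growth_one : quadratic_growth (fun _ => 1).
Proof.
apply (quadratic_growth_RtoC (fun _ => 1%R) 1); [lra|].
intros n. rewrite Rabs_R1. assert (h := INR_S_mult_ge_1 n). lra.
Qed.

Lemma quadratic_growth_sign : quadratic_growth (fun n => RtoC ((-1) ^ n)).
Proof.
apply (quadratic_growth_RtoC _ 1); [lra|].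
intros n. rewrite pow_1_abs. assert (h := INR_S_mult_ge_1 n). lra.
Qed.

Lemma quadratic_growth_INR : quadratic_growth (fun n => RtoC (INR (S n))).
Proof.
apply (quadratic_growth_RtoC _ 1); [lra|].
intros n. rewrite Rabs_pos_eq by apply pos_INR. rewrite !S_INR.
assert (h := pos_INR n). nra.
Qed.

Lemma quadratic_growth_INR2 :
  quadratic_growth (fun n => RtoC (INR (S n) * INR (S (S n)))).
Proof.
apply (quadratic_growth_RtoC _ 1); [lra|].
intros n. assert (h := INR_S_mult_ge_1 n). rewrite Rabs_pos_eq; lra.
Qed.

Lemma is_Cpseries_one (z : C) : in_disk z -> is_Cpseries (fun _ => 1) z (1 / (1 - z)).
Proof.
intros hz. rewrite <- (Cmult_1_l z) at 2.
refine (is_Cpseries_div 1 _ _ z 1 hz quadratic_growth_one _ _ _ (is_Cpseries_delta z)).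
- rewrite Cmult_1_l. now apply in_disk_minus_neq.
- reflexivity.
- intros n. ring.
Qed.

Lemma is_Cpseries_sign (z : C) : in_disk z ->
  is_Cpseries (fun n => RtoC ((-1) ^ n)) z (1 / (1 + z)).
Proof.
intros hz. replace (1 + z) with (1 - - (1) * z) by ring.
refine (is_Cpseries_div (- (1)) _ _ z 1 hz quadratic_growth_sign _ _ _
  (is_Cpseries_delta z)).
- replace (1 - - (1) * z) with (1 + z) by ring. now apply in_disk_plus_neq.
- reflexivity.
- intros n. rewrite <- tech_pow_Rmult, RtoC_mult. ring.
Qed.

Lemma is_Cpseries_INR (z : C) : in_disk z ->
  is_Cpseries (fun n => RtoC (INR (S n))) z (1 / ((1 - z) * (1 - z))).
Proof.
intros hz. assert (hne := in_disk_minus_neq z hz).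
replace (1 / ((1 - z) * (1 - z))) with ((1 / (1 - z)) / (1 - 1 * z))
  by (rewrite Cmult_1_l; now field).
refine (is_Cpseries_div 1 _ _ z _ hz quadratic_growth_INR _ _ _
  (is_Cpseries_one z hz)).
- now rewrite Cmult_1_l.
- reflexivity.
- intros n. rewrite (S_INR (S n)), RtoC_plus. ring.
Qed.

Lemma is_Cpseries_INR2 (z : C) : in_disk z ->
  is_Cpseries (fun n => RtoC (INR (S n) * INR (S (S n)))) z
    (2 / ((1 - z) * (1 - z) * (1 - z))).
Proof.
intros hz. assert (hne := in_disk_minus_neq z hz).
replace (2 / ((1 - z) * (1 - z) * (1 - z)))
  with ((2 * (1 / ((1 - z) * (1 - z)))) / (1 - 1 * z))
  by (rewrite Cmult_1_l; now field).
refine (is_Cpseries_div 1 _ _ z _ hz quadratic_growth_INR2 _ _ _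
  (is_Cpseries_scal 2 _ _ _ (is_Cpseries_INR z hz))).
- now rewrite Cmult_1_l.
- simpl. rewrite <- RtoC_mult. f_equal. ring.
- intros n. rewrite <- !RtoC_mult, <- RtoC_plus. f_equal.
  rewrite !S_INR. ring.
Qed.

Lemma is_Cpseries_dilate (e : C) (a : nat -> C) (z l : C) :
  is_Cpseries a (e * z) l -> is_Cpseries (fun n => Cpow e n * a n) z l.
Proof.
intros H%is_Cpseries_series. apply is_Cpseries_series.
refine (is_series_ext (V := C_NormedModule) _ _ _ _ H).
intros n. rewrite Cpow_mult_l.
change (a n * (Cpow e n * Cpow z n) = Cpow e n * a n * Cpow z n :> C). ring.
Qed.

(** * Reduction of the convolution to a closed form *)

(** The solution h' of h' + g' = 1 / (1 - z)^2 and g' = omega h', where 1 + omega = (1 + a) (1 -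
    z^2) / (1 - a z^2). *)
Definition dh (a : R) (z : C) : C :=
  (1 - a * (z * z)) / ((1 + a) * ((1 - z) * (1 - z) * (1 - z) * (1 + z))).

Definition dg (a : R) (z : C) : C := 1 / ((1 - z) * (1 - z)) - dh a z.

Lemma RtoC_neq (x y : R) : x <> y -> RtoC x <> RtoC y.
Proof. intros h E%RtoC_inj. now apply h. Qed.

Lemma one_plus_a_neq (a : R) : (0 <= a < 1)%R -> 1 + a <> 0.
Proof. intros ha. rewrite <- RtoC_plus. apply RtoC_neq. lra. Qed.

Lemma dilatation_denominator_neq (a : R) (z : C) :
  (0 <= a < 1)%R -> in_disk z -> 1 - a * (z * z) <> 0.
Proof.
unfold in_disk. intros ha hz E.
assert (H : (Cmod (a * (z * z)) = 1)%R).
{ replace (a * (z * z)) with (RtoC 1)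
    by (rewrite <- (Cplus_0_r (a * (z * z))), <- E; ring).
  apply Cmod_1. }
rewrite !Cmod_mult, Cmod_R, Rabs_pos_eq in H by lra.
assert (h := Cmod_ge_0 z). nra.
Qed.

Lemma is_Cderive_of_analytic (f : C -> C) (z : C) :
  analytic_on_disk f -> in_disk z -> is_Cderive f z (C_derive f z).
Proof. intros hf hz. exact (C_derive_correct f z z (hf z hz)). Qed.

Lemma is_Cderive_half_plane (z : C) : in_disk z ->
  is_Cderive (fun w => w / (1 - w)) z (1 / ((1 - z) * (1 - z))).
Proof.
intros hz. assert (hne := in_disk_minus_neq z hz).
eapply is_Cderive_eq.
- apply (is_Cderive_div (fun w => w) (fun w => 1 - w)); [exact hne | |].
  + apply is_Cderive_id.
  + apply is_Cderive_minus; [apply is_Cderive_const | apply is_Cderive_id].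
- cbv beta. field. exact hne.
Qed.

Lemma derivative_from_dilatation (a : R) (h g : C -> C) :
  (0 <= a < 1)%R -> analytic_on_disk h -> analytic_on_disk g ->
  (forall z : C, in_disk z -> h z + g z = z / (1 - z)) ->
  has_dilatation h g
    (fun z => (RtoC a - Cpow z 2) / (1 - RtoC a * Cpow z 2)) ->
  forall z, in_disk z -> is_Cderive h z (dh a z) /\ is_Cderive g z (dg a z).
Proof.
intros ha h_an g_an hg dil z hz.
assert (Hh := is_Cderive_of_analytic h z h_an hz).
assert (Hg := is_Cderive_of_analytic g z g_an hz).
destruct (dil z hz) as [hp0 hq].
set (p := C_derive h z) in *. set (q := C_derive g z) in *.
assert (Hs : p + q = 1 / ((1 - z) * (1 - z))).
{ rewrite <- (is_C_derive_unique _ _ _ (is_Cderive_half_plane z hz)).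
  symmetry. apply is_C_derive_unique.
  apply (is_Cderive_ext_disk (fun w => h w + g w)); [exact hz | exact hg|].
  now apply is_Cderive_plus. }
assert (hm := in_disk_minus_neq z hz). assert (hpl := in_disk_plus_neq z hz).
assert (ha1 := one_plus_a_neq a ha).
assert (hden := dilatation_denominator_neq a z ha hz).
assert (Hq : q = p * ((a - z * z) / (1 - a * (z * z)))).
{ replace (Cpow z 2) with (z * z) in hq by (simpl; ring).
  rewrite <- hq. field. exact hp0. }
assert (Hp : p = dh a z).
{ assert (E : (1 + a) * ((1 - z) * (1 + z)) * p
    = (1 - a * (z * z)) * (1 / ((1 - z) * (1 - z)))).
  { rewrite <- Hs, Hq. field. exact hden. }
  assert (hX : (1 + a) * ((1 - z) * (1 + z)) <> 0)
    by (repeat apply Cmult_neq_0; assumption).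
  transitivity ((1 + a) * ((1 - z) * (1 + z)) * p / ((1 + a) * ((1 - z) * (1 + z)))).
  - field. repeat split; assumption.
  - rewrite E. unfold dh. field. repeat split; assumption. }
split.
- now rewrite <- Hp.
- replace (dg a z) with q; [exact Hg|].
  unfold dg. rewrite <- Hp, <- Hs. ring.
Qed.

(* Partial fractions of [dh a]. *)
Definition dh_coef (a : R) (n : nat) : C :=
  / (1 + a) * ((1 - a) / 4 * RtoC (INR (S n) * INR (S (S n)))
    + (1 + 3 * a) / 4 * RtoC (INR (S n))
    + (1 - a) / 8 * 1 + (1 - a) / 8 * RtoC ((-1) ^ n)).

Lemma quadratic_growth_dh_coef (a : R) : quadratic_growth (dh_coef a).
Proof.
apply quadratic_growth_scal. repeat apply quadratic_growth_plus;
  apply quadratic_growth_scal.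
- apply quadratic_growth_INR2.
- apply quadratic_growth_INR.
- apply quadratic_growth_one.
- apply quadratic_growth_sign.
Qed.

Lemma is_Cpseries_dh (a : R) (z : C) : (0 <= a < 1)%R -> in_disk z ->
  is_Cpseries (dh_coef a) z (dh a z).
Proof.
intros ha hz.
assert (hm := in_disk_minus_neq z hz). assert (hpl := in_disk_plus_neq z hz).
assert (ha1 := one_plus_a_neq a ha).
replace (dh a z) with
  (/ (1 + a) * ((1 - a) / 4 * (2 / ((1 - z) * (1 - z) * (1 - z)))
    + (1 + 3 * a) / 4 * (1 / ((1 - z) * (1 - z)))
    + (1 - a) / 8 * (1 / (1 - z)) + (1 - a) / 8 * (1 / (1 + z)))).
- unfold dh_coef. apply is_Cpseries_scal. apply is_Cpseries_plus;
    [apply is_Cpseries_plus; [apply is_Cpseries_plus|]|]; apply is_Cpseries_scal.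
  + now apply is_Cpseries_INR2.
  + now apply is_Cpseries_INR.
  + now apply is_Cpseries_one.
  + now apply is_Cpseries_sign.
- unfold dh. field. repeat split; try assumption.
Qed.

Lemma is_Cpseries_times_index (b : nat -> C) (z l : C) :
  is_Cpseries b z l ->
  is_Cpseries (fun n => RtoC (INR n) * integrated b n) z (z * l).
Proof.
intros H. refine (is_Cpseries_ext _ _ _ _ _ (is_Cpseries_shift b z l H)).
intros [|n]; unfold integrated; [ring|].
field. apply RtoC_neq, not_0_INR. lia.
Qed.

(** Here [df] stands for z f'. The n-th coefficient of [phi] is u e^n (1 + c n) / 2 for n > 0; the
    power e^n moves the evaluation point to e z, and the factor n turns f into z f'. *)
Lemma hadamard_slanted (phi f df : C -> C) (b : nat -> C) (e u c : C) :
  Cmod e = 1%R -> b O = 0 ->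
  (forall z, in_disk z -> is_Cpseries b z (f z)) ->
  (forall z, in_disk z -> is_Cpseries (fun n => RtoC (INR n) * b n) z (df z)) ->
  (forall z, in_disk z -> phi z = u * (/ 2 * ((e * z) / (1 - e * z)
    + c * ((e * z) / ((1 - e * z) * (1 - e * z)))))) ->
  forall z, in_disk z ->
    hadamard phi f z = u * (/ 2 * (f (e * z) + c * df (e * z))).
Proof.
intros he hb0 hf hdf hphi z hz.
assert (hdisk : forall z, in_disk z -> in_disk (e * z)).
{ intros y hy. unfold in_disk. rewrite Cmod_mult, he, Rmult_1_l. exact hy. }
assert (Hphi : forall y, in_disk y -> is_Cpseries (fun n => Cpow e n *
  (u * (/ 2 * ((match n with O => 0 | S k => 1 end)
    + c * (match n with O => 0 | S k => RtoC (INR (S k)) end))))) y (phi y)).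
{ intros y hy. rewrite (hphi y hy). apply is_Cpseries_dilate.
  apply is_Cpseries_scal, is_Cpseries_scal, is_Cpseries_plus;
    [|apply is_Cpseries_scal].
  - replace (e * y / (1 - e * y)) with ((e * y) * (1 / (1 - e * y)))
      by (field; now apply in_disk_minus_neq, hdisk).
    apply (is_Cpseries_shift (fun _ => 1)). now apply is_Cpseries_one, hdisk.
  - replace (e * y / ((1 - e * y) * (1 - e * y)))
      with ((e * y) * (1 / ((1 - e * y) * (1 - e * y))))
      by (field; now apply in_disk_minus_neq, hdisk).
    apply (is_Cpseries_shift (fun n => RtoC (INR (S n)))).
    now apply is_Cpseries_INR, hdisk. }
unfold hadamard. apply C_series_is_series.
assert (Hs : is_Cpseries (fun n => u * (/ 2 * (b n + c * (RtoC (INR n) * b n))))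
  (e * z) (u * (/ 2 * (f (e * z) + c * df (e * z))))).
{ apply is_Cpseries_scal, is_Cpseries_scal, is_Cpseries_plus; [|apply is_Cpseries_scal].
  - now apply hf, hdisk.
  - now apply hdf, hdisk. }
apply is_Cpseries_series in Hs.
refine (is_series_ext (V := C_NormedModule) _ _ _ _ Hs).
intros n. rewrite (coefs_unique _ _ Hphi n), (coefs_unique _ _ hf n), Cpow_mult_l.
(* At index 0 both kernels have coefficient 0 instead of 1 + c n, so the constant term of f has to
   vanish. *)
destruct n as [|n]; [rewrite hb0|]; cbv beta iota;
  match goal with |- ?x = ?y => change (x = y :> C) end; ring.
Qed.

Lemma Cmod_cis (t : R) : Cmod (cis t) = 1%R.
Proof.
unfold Cmod, cis. simpl. rewrite !Rmult_1_r, Rplus_comm.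
change (sqrt (Rsqr (sin t) + Rsqr (cos t)) = 1%R). rewrite sin2_cos2. apply sqrt_1.
Qed.

Lemma cis_plus (s t : R) : cis (s + t) = cis s * cis t.
Proof.
unfold cis, Cmult. simpl. rewrite cos_plus, sin_plus. f_equal. ring.
Qed.

Lemma cis_opp (t : R) : cis (- t) = Cconj (cis t).
Proof. unfold cis, Cconj. simpl. now rewrite cos_neg, sin_neg. Qed.

Lemma cis_conj_mult (t : R) : Cconj (cis t) * cis t = 1.
Proof. rewrite Cmult_comm, <- Cmod2_conj, Cmod_cis. f_equal. ring. Qed.

Definition dil_ratio (a : R) : R := ((1 - a) / (1 + a))%R.

Lemma RtoC_dil_ratio (a : R) : (0 <= a < 1)%R -> RtoC (dil_ratio a) = (1 - a) / (1 + a).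
Proof.
intros ha. unfold dil_ratio. rewrite RtoC_div, RtoC_minus, RtoC_plus; [reflexivity | lra].
Qed.

Lemma in_disk_cis (t : R) (z : C) : in_disk z -> in_disk (cis t * z).
Proof. unfold in_disk. now rewrite Cmod_mult, Cmod_cis, Rmult_1_l. Qed.

(** Over the common denominator (1 - w)^2 the numerators agree because (1 + c) / 2 = 1 / (1 + a).
    The analogue for [g_slanted] uses (1 - c) / 2 = a / (1 + a). *)
Lemma h_slanted_eq (a alpha : R) (z : C) : (0 <= a < 1)%R -> in_disk z ->
  let w := cis alpha * z in
  h_slanted a alpha z =
  Cconj (cis alpha) * (/ 2 * (w / (1 - w) + dil_ratio a * (w / ((1 - w) * (1 - w))))).
Proof.
intros ha hz w.
assert (hne := in_disk_minus_neq w (in_disk_cis alpha z hz)).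
assert (ha1 := one_plus_a_neq a ha).
assert (E : z = Cconj (cis alpha) * w)
  by (unfold w; rewrite Cmult_assoc, cis_conj_mult; ring).
unfold h_slanted. fold w. rewrite RtoC_plus, RtoC_dil_ratio by exact ha.
replace (/ 2 * cis alpha * Cpow z 2) with (/ 2 * (Cconj (cis alpha) * (w * w))).
- rewrite E. simpl. field. now split.
- simpl. replace (Cconj (cis alpha) * (w * w)) with (z * w) by (rewrite E; ring).
  unfold w. ring.
Qed.

Lemma g_slanted_eq (a alpha : R) (z : C) : (0 <= a < 1)%R -> in_disk z ->
  let w := cis alpha * z in
  g_slanted a alpha z =
  cis alpha * (/ 2 * (w / (1 - w) + - dil_ratio a * (w / ((1 - w) * (1 - w))))).
Proof.
intros ha hz w.
assert (hne := in_disk_minus_neq w (in_disk_cis alpha z hz)).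
assert (ha1 := one_plus_a_neq a ha).
unfold g_slanted. fold w. rewrite RtoC_plus, RtoC_dil_ratio by exact ha.
replace (2 * alpha)%R with (alpha + alpha)%R by ring.
replace (3 * alpha)%R with (alpha + (alpha + alpha))%R by ring.
rewrite !cis_plus.
replace (a * (cis alpha * cis alpha) * z) with (a * (cis alpha * w))
  by (unfold w; ring).
replace (/ 2 * (cis alpha * (cis alpha * cis alpha)) * Cpow z 2)
  with (/ 2 * (cis alpha * (w * w))) by (unfold w; simpl; ring).
simpl. field. now split.
Qed.

(** [conv_h] and [conv_g] are the functions H and G of the overview, in the rotated variable w. *)
Definition conv_h (a : R) (h : C -> C) (w : C) : C :=
  / 2 * (h w + dil_ratio a * (w * dh a w)).

Definition conv_g (a : R) (g : C -> C) (w : C) : C :=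
  / 2 * (g w + - dil_ratio a * (w * dg a w)).

Lemma convolution_eq (a alpha : R) (h g : C -> C) :
  (0 <= a < 1)%R -> h 0 = 0 ->
  (forall z, in_disk z -> h z + g z = z / (1 - z)) ->
  (forall z, in_disk z -> is_Cderive h z (dh a z) /\ is_Cderive g z (dg a z)) ->
  forall z, in_disk z ->
  harmonic_convolution (h_slanted a alpha) (g_slanted a alpha) h g z
  = Cconj (cis alpha) * conv_h a h (cis alpha * z)
    + Cconj (cis alpha * conv_g a g (cis alpha * z)).
Proof.
intros ha h0 hg hd z hz.
assert (g0 : g 0 = 0).
{ assert (H := hg 0). rewrite h0, Cplus_0_l in H. rewrite H.
  - unfold Cdiv. ring.
  - unfold in_disk. rewrite Cmod_0. lra. }
assert (Hh := fun b => is_Cpseries_integrated h (dh a) b h0).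
assert (Hdg : forall y, in_disk y ->
  is_Cpseries (fun n => RtoC (INR (S n)) + - (1) * dh_coef a n) y (dg a y)).
{ intros y hy. unfold dg.
  replace (1 / ((1 - y) * (1 - y)) - dh a y)
    with (1 / ((1 - y) * (1 - y)) + - (1) * dh a y) by ring.
  apply is_Cpseries_plus; [now apply is_Cpseries_INR|].
  now apply is_Cpseries_scal, is_Cpseries_dh. }
assert (Hqg : quadratic_growth (fun n => RtoC (INR (S n)) + - (1) * dh_coef a n)).
{ apply quadratic_growth_plus; [apply quadratic_growth_INR|].
  apply quadratic_growth_scal, quadratic_growth_dh_coef. }
unfold harmonic_convolution. f_equal; [|f_equal].
- refine (hadamard_slanted _ h (fun w => w * dh a w) (integrated (dh_coef a))
    (cis alpha) (Cconj (cis alpha)) (dil_ratio a) (Cmod_cis alpha) eq_refl _ _ _ z hz).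
  + apply (is_Cpseries_integrated h (dh a)); trivial.
    * apply quadratic_growth_dh_coef.
    * intros y hy. now apply hd.
    * intros y hy. now apply is_Cpseries_dh.
  + intros y hy. now apply is_Cpseries_times_index, is_Cpseries_dh.
  + intros y hy. now apply h_slanted_eq.
- refine (hadamard_slanted _ g (fun w => w * dg a w) (integrated _)
    (cis alpha) (cis alpha) (- dil_ratio a) (Cmod_cis alpha) eq_refl _ _ _ z hz).
  + apply (is_Cpseries_integrated g (dg a)); trivial.
    * exact Hqg.
    * intros y hy. now apply hd.
    * exact Hdg.
  + intros y hy. now apply is_Cpseries_times_index, Hdg.
  + intros y hy. now apply g_slanted_eq.
Qed.

(** * Monotonicity along the level curves *)

(* The identity behind the bound is t^3 - 5 t^2 + 3 t + 9 = (t - 3)^2 (t + 1). *)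
Lemma jacobian_factor_pos (r t u k : R) :
  (0 < r -> 0 < t -> r * t = 1 -> -3 < u -> 0 <= k <= / 4 ->
  0 < 3 + t + k * (9 * r + 3 * u * (1 + t) + t ^ 2))%R.
Proof.
intros hr ht hrt hu hk.
assert (h4 : (0 <= 3 + t + / 4 * (9 * r - 9 - 9 * t + t ^ 2))%R).
{ replace (3 + t + / 4 * (9 * r - 9 - 9 * t + t ^ 2))%R
    with (/ 4 * (r * ((t - 3) ^ 2 * (t + 1))))%R by (simpl; nra).
  assert (0 <= (t - 3) ^ 2)%R by apply pow2_ge_0.
  apply Rmult_le_pos; [lra|]. apply Rmult_le_pos; [lra|].
  apply Rmult_le_pos; lra. }
assert (hu' : (0 < 3 * (u + 3) * (1 + t))%R) by (apply Rmult_lt_0_compat; lra).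
replace (9 * r + 3 * u * (1 + t) + t ^ 2)%R
  with ((9 * r - 9 - 9 * t + t ^ 2) + 3 * (u + 3) * (1 + t))%R by ring.
set (X := (9 * r - 9 - 9 * t + t ^ 2)%R) in *.
set (Y := (3 * (u + 3) * (1 + t))%R) in *.
(* 3 + t + k X is affine in k, positive at 0 and nonnegative at 1/4. Strictness comes from k Y when
   k > 0, and from 3 + t when k = 0. *)
destruct (Rlt_or_le 0 k) as [hk0|hk0].
- assert (0 < k * Y)%R by now apply Rmult_lt_0_compat.
  assert (0 <= 3 + t + k * X)%R; [|lra].
  destruct (Rle_or_lt 0 X); nra.
- replace k with 0%R by lra. lra.
Qed.

(* With zeta = x + i y in the right half-plane, [shear_re] is the real part of
   zeta + k (zeta^3 - 1 / zeta) and [shear_im] is the imaginary part of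
   3 zeta^2 + 2 log zeta. *)
Definition shear_re (k x y : R) : R :=
  (x + k * (x ^ 3 - 3 * x * y ^ 2 - x / (x ^ 2 + y ^ 2)))%R.

Definition shear_im (x y : R) : R := (6 * x * y + 2 * atan (y / x))%R.

(* On a level curve [shear_im x y = v], the abscissa as a function of the slope
   s = y / x. *)
Definition level_abscissa (v s : R) : R := sqrt ((v - 2 * atan s) / (6 * s)).

Lemma level_abscissa_pos (v s : R) :
  (0 < s -> 2 * atan s < v -> 0 < level_abscissa v s)%R.
Proof.
intros hs hv. apply sqrt_lt_R0, Rdiv_lt_0_compat; lra.
Qed.

Lemma level_abscissa_spec (v s : R) :
  (0 < s -> 2 * atan s < v ->
   shear_im (level_abscissa v s) (level_abscissa v s * s) = v)%R.
Proof.
intros hs hv. assert (hp := level_abscissa_pos v s hs hv).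
unfold shear_im.
replace (level_abscissa v s * s / level_abscissa v s)%R with s by (field; lra).
replace (6 * level_abscissa v s * (level_abscissa v s * s))%R
  with (level_abscissa v s * level_abscissa v s * (6 * s))%R by ring.
unfold level_abscissa at 1 2. rewrite sqrt_sqrt.
- field. lra.
- apply Rlt_le, Rdiv_lt_0_compat; lra.
Qed.

Lemma atan_pos (s : R) : (0 < s -> 0 < atan s)%R.
Proof. intros hs. rewrite <- atan_0. now apply atan_increasing. Qed.

Lemma shear_im_pos (x y : R) : (0 < x -> 0 < y -> 0 < shear_im x y)%R.
Proof.
intros hx hy. unfold shear_im.
assert (0 < atan (y / x))%R by (apply atan_pos, Rdiv_lt_0_compat; lra).
nra.
Qed.

(** Reflection in the real axis reduces negative levels to positive ones; a positive level lies
    entirely in y > 0. *)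
Lemma shear_im_opp (x y : R) : shear_im x (- y) = (- shear_im x y)%R.
Proof.
unfold shear_im. replace (- y / x)%R with (- (y / x))%R by (unfold Rdiv; ring).
rewrite atan_opp. ring.
Qed.

Lemma shear_re_opp (k x y : R) : shear_re k x (- y) = shear_re k x y.
Proof. unfold shear_re. now replace ((- y) ^ 2)%R with (y ^ 2)%R by ring. Qed.

Lemma shear_im_0 (x : R) : shear_im x 0 = 0%R.
Proof.
unfold shear_im. unfold Rdiv. rewrite Rmult_0_l, atan_0. ring.
Qed.

Lemma shear_im_sign (x y : R) : (0 < x -> 0 < shear_im x y -> 0 < y)%R.
Proof.
intros hx hv. destruct (Rtotal_order y 0) as [h|[h|h]]; [|subst y|exact h].
- assert (H := shear_im_pos x (- y) hx ltac:(lra)). rewrite shear_im_opp in H. lra.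
- rewrite shear_im_0 in hv. lra.
Qed.

Lemma shear_im_eq_0 (x y : R) : (0 < x -> shear_im x y = 0 -> y = 0)%R.
Proof.
intros hx hv. destruct (Rtotal_order y 0) as [h|[h|h]]; [|exact h|].
- assert (H := shear_im_pos x (- y) hx ltac:(lra)). rewrite shear_im_opp in H. lra.
- assert (H := shear_im_pos x y hx h). lra.
Qed.

Lemma level_abscissa_eq (x y : R) : (0 < x -> 0 < y ->
  0 < y / x /\ 2 * atan (y / x) < shear_im x y /\
  level_abscissa (shear_im x y) (y / x) = x)%R.
Proof.
intros hx hy. assert (hs : (0 < y / x)%R) by now apply Rdiv_lt_0_compat.
repeat split; [exact hs | unfold shear_im; nra |].
unfold level_abscissa, shear_im.
replace ((6 * x * y + 2 * atan (y / x) - 2 * atan (y / x)) / (6 * (y / x)))%R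
  with (Rsqr x) by (unfold Rsqr; field; lra).
apply sqrt_Rsqr. lra.
Qed.

(** The value is what implicit differentiation of 6 p^2 s + 2 atan s = v in s gives. *)
Lemma is_derive_level_abscissa (v s : R) :
  (0 < s)%R -> (2 * atan s < v)%R ->
  let p := level_abscissa v s in
  is_derive (level_abscissa v) s
    (- (p ^ 2 + / (3 * (1 + s ^ 2))) / (2 * p * s))%R.
Proof.
intros hs hv p. assert (hp := level_abscissa_pos v s hs hv).
assert (hq : (0 < (v - 2 * atan s) / (6 * s))%R) by (apply Rdiv_lt_0_compat; lra).
assert (hm : (0 < 1 + s ^ 2)%R) by (assert (h := pow2_ge_0 s); lra).
assert (hpp : (p ^ 2 = (v - 2 * atan s) / (6 * s))%R).
{ unfold p, level_abscissa. rewrite pow2_sqrt; lra. }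
evar_last.
- unfold level_abscissa. apply is_derive_sqrt; [|exact hq].
  auto_derive; [lra | reflexivity].
- cbv beta. change (sqrt ((v - 2 * atan s) / (6 * s))%R) with p.
  replace (v + - (2 * atan s))%R with (p ^ 2 * (6 * s))%R by (rewrite hpp; field; lra).
  fold p in hp. field. repeat split; try lra.
Qed.

Lemma shear_re_level_decreasing (k v s1 s2 : R) :
  (0 <= k <= / 4)%R -> (0 < s1)%R -> (s1 < s2)%R -> (2 * atan s2 < v)%R ->
  (shear_re k (level_abscissa v s2) (level_abscissa v s2 * s2)
   < shear_re k (level_abscissa v s1) (level_abscissa v s1 * s1))%R.
Proof.
intros hk h1 h12 h2.
set (rho := fun s => shear_re k (level_abscissa v s) (level_abscissa v s * s)).
change (rho s2 < rho s1)%R.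
(* The total derivative of [shear_re] along the curve (p, p s), with [dp] and [dy] the derivatives
   of its two coordinates. *)
set (d := fun s => let p := level_abscissa v s in
  let dp := (- (p ^ 2 + / (3 * (1 + s ^ 2))) / (2 * p * s))%R in
  let dy := (dp * s + p)%R in
  (dp + k * (3 * p ^ 2 * dp - 3 * dp * (p * s) ^ 2 - 6 * p * (p * s) * dy
    - (dp * (p ^ 2 + (p * s) ^ 2) - p * (2 * p * dp + 2 * (p * s) * dy))
      / (p ^ 2 + (p * s) ^ 2) ^ 2))%R).
(* Since atan increases, the constraint at the larger slope holds on the whole interval. *)
assert (hdom : forall s, (s1 <= s <= s2)%R -> (0 < s /\ 2 * atan s < v)%R).
{ intros s hs. split; [lra|]. destruct (Rle_lt_or_eq_dec s s2) as [h|h]; [lra| |].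
  - assert (H := atan_increasing s s2 h). lra.
  - subst s. exact h2. }
assert (hd : forall s, (s1 <= s <= s2)%R -> is_derive rho s (d s)).
{ intros s hs. destruct (hdom s hs) as [hs0 hsv].
  assert (hp := level_abscissa_pos v s hs0 hsv).
  assert (Hp := is_derive_level_abscissa v s hs0 hsv).
  assert (hpp : (0 < level_abscissa v s ^ 2)%R) by now apply pow_lt.
  assert (hp2 := pow2_ge_0 (level_abscissa v s * s)).
  unfold rho, shear_re. auto_derive.
  - repeat split; try (eexists; exact Hp). simpl in *. lra.
  - replace (Derive (fun x => level_abscissa v x) s)
      with (- (level_abscissa v s ^ 2 + / (3 * (1 + s ^ 2)))
        / (2 * level_abscissa v s * s))%R by (symmetry; now apply is_derive_unique).
    unfold d. cbv zeta.
    generalize (- (level_abscissa v s ^ 2 + / (3 * (1 + s ^ 2)))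
        / (2 * level_abscissa v s * s))%R. intros dp.
    field. simpl in *. lra. }
destruct (MVT_gen rho s1 s2 d) as [s [hs E]].
{ intros s hs. apply hd. rewrite Rmin_left, Rmax_right in hs by lra. lra. }
{ intros s hs. apply continuity_pt_filterlim.
  apply (ex_derive_continuous (K := R_AbsRing) (V := R_NormedModule)).
  eexists. apply hd. rewrite Rmin_left, Rmax_right in hs by lra. lra. }
rewrite Rmin_left, Rmax_right in hs by lra.
enough (d s < 0)%R by nra.
destruct (hdom s hs) as [hs0 hsv].
assert (hp := level_abscissa_pos v s hs0 hsv).
unfold d. set (p := level_abscissa v s) in *. cbv zeta.
assert (hm : (0 < 1 + s ^ 2)%R) by (assert (h := pow2_ge_0 s); lra).
assert (hpp : (0 < p ^ 2)%R) by now apply pow_lt.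
assert (hr : (0 < p ^ 2 * (1 + s ^ 2))%R) by now apply Rmult_lt_0_compat.
(* With x = p and y = p s, the arguments are r = x^2 + y^2, t = 1 / r and u = (x^2 - 3 y^2) / r, and
   u > -3 because x is not 0. *)
assert (H := jacobian_factor_pos (p ^ 2 * (1 + s ^ 2)) (/ (p ^ 2 * (1 + s ^ 2)))
  ((1 - 3 * s ^ 2) / (1 + s ^ 2)) k hr (Rinv_0_lt_compat _ hr)).
specialize (H ltac:(field; lra)).
specialize (H ltac:(apply Rlt_div_r; lra) hk).
match goal with |- (?e < 0)%R => set (D := e) end.
match type of H with (0 < ?e)%R => assert (E' : (D = - (e * (p / (6 * s))))%R) end.
{ unfold D. field. repeat split; try lra.
  all: assert (hps : (0 < p ^ 2 + (p * s) ^ 2)%R)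
    by (assert (h := pow2_ge_0 (p * s)); lra); lra. }
rewrite E'.
match type of H with (0 < ?e)%R => assert (0 < e * (p / (6 * s)))%R end.
{ apply Rmult_lt_0_compat; [exact H|]. apply Rdiv_lt_0_compat; lra. }
lra.
Qed.

Lemma shear_injective_pos (k x1 y1 x2 y2 : R) :
  (0 <= k <= / 4)%R -> (0 < x1)%R -> (0 < x2)%R -> (0 < y1)%R -> (0 < y2)%R ->
  shear_im x1 y1 = shear_im x2 y2 -> shear_re k x1 y1 = shear_re k x2 y2 ->
  x1 = x2 /\ y1 = y2.
Proof.
intros hk hx1 hx2 hy1 hy2 hi hr.
destruct (level_abscissa_eq x1 y1 hx1 hy1) as [hs1 [hv1 E1]].
destruct (level_abscissa_eq x2 y2 hx2 hy2) as [hs2 [hv2 E2]].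
rewrite hi in hv1, E1.
set (v := shear_im x2 y2) in *. set (s1 := (y1 / x1)%R) in *. set (s2 := (y2 / x2)%R) in *.
assert (F1 : y1 = (x1 * s1)%R) by (unfold s1; field; lra).
assert (F2 : y2 = (x2 * s2)%R) by (unfold s2; field; lra).
destruct (Rtotal_order s1 s2) as [h|[h|h]].
- assert (H := shear_re_level_decreasing k v s1 s2 hk hs1 h hv2).
  rewrite E1, E2, <- F1, <- F2 in H. lra.
- assert (Ex : x1 = x2) by (rewrite <- E1, <- E2; now f_equal).
  split; [exact Ex|]. rewrite F1, F2, Ex, h. reflexivity.
- assert (H := shear_re_level_decreasing k v s2 s1 hk hs2 h hv1).
  rewrite E1, E2, <- F1, <- F2 in H. lra.
Qed.

(** The level 0 is the positive real axis. The slope is constantly 0 there and no longer a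
    parameter, so x itself replaces it. *)
Lemma shear_re_axis_lt (k x1 x2 : R) :
  (0 <= k)%R -> (0 < x1)%R -> (x1 < x2)%R ->
  (shear_re k x1 0 < shear_re k x2 0)%R.
Proof.
intros hk h1 h12.
assert (E : forall x, (0 < x)%R -> shear_re k x 0 = (x + k * (x ^ 3 - / x))%R).
{ intros x hx. unfold shear_re. field. lra. }
rewrite !E by lra.
assert (/ x2 < / x1)%R by (apply Rinv_lt_contravar; nra).
assert (x1 ^ 3 <= x2 ^ 3)%R by (apply pow_incr; lra).
nra.
Qed.

Lemma shear_injective (k x1 y1 x2 y2 : R) :
  (0 <= k <= / 4)%R -> (0 < x1)%R -> (0 < x2)%R ->
  shear_im x1 y1 = shear_im x2 y2 -> shear_re k x1 y1 = shear_re k x2 y2 ->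
  x1 = x2 /\ y1 = y2.
Proof.
intros hk hx1 hx2 hi hr.
destruct (Rtotal_order 0 (shear_im x1 y1)) as [h|[h|h]].
- apply (shear_injective_pos k); trivial;
    [apply (shear_im_sign x1) | apply (shear_im_sign x2)]; trivial; lra.
- assert (y1 = 0%R) by (apply (shear_im_eq_0 x1); trivial; lra).
  assert (y2 = 0%R) by (apply (shear_im_eq_0 x2); trivial; lra). subst y1 y2.
  split; [|reflexivity].
  destruct (Rtotal_order x1 x2) as [l|[l|l]]; [|exact l|].
  + assert (H := shear_re_axis_lt k x1 x2 (proj1 hk) hx1 l). lra.
  + assert (H := shear_re_axis_lt k x2 x1 (proj1 hk) hx2 l). lra.
- destruct (shear_injective_pos k x1 (- y1) x2 (- y2)) as [Ex Ey]; trivial.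
  + apply (shear_im_sign x1); [exact hx1|]. rewrite shear_im_opp. lra.
  + apply (shear_im_sign x2); [exact hx2|]. rewrite shear_im_opp. lra.
  + rewrite !shear_im_opp. lra.
  + now rewrite !shear_re_opp.
  + split; [exact Ex | lra].
Qed.

(** * Paths inside a level curve *)

(** The level equation is required on a two-sided neighbourhood of each parameter, also at 0 and 1,
    because [continuous] is two-sided and the equation is later used to rewrite the path locally. *)
Definition level_path (x y : R -> R) (v : R) : Prop :=
  forall t : R, (0 <= t <= 1)%R ->
    continuous x t /\ continuous y t /\
    locally t (fun u => (0 < x u)%R /\ shear_im (x u) (y u) = v).

Lemma level_path_pos (x1 y1 x2 y2 : R) :
  (0 < x1)%R -> (0 < x2)%R -> (0 < y1)%R -> (0 < y2)%R ->
  shear_im x1 y1 = shear_im x2 y2 ->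
  exists x y : R -> R, x 0%R = x1 /\ y 0%R = y1 /\ x 1%R = x2 /\ y 1%R = y2 /\
    level_path x y (shear_im x1 y1).
Proof.
intros hx1 hx2 hy1 hy2 hi.
destruct (level_abscissa_eq x1 y1 hx1 hy1) as [hs1 [hv1 E1]].
destruct (level_abscissa_eq x2 y2 hx2 hy2) as [hs2 [hv2 E2]].
rewrite <- hi in hv2, E2.
set (v := shear_im x1 y1) in *. set (s1 := (y1 / x1)%R) in *. set (s2 := (y2 / x2)%R) in *.
(* The slope is interpolated linearly. The condition 2 atan s < v at the larger endpoint controls
   all the slopes in between. *)
set (s := fun t : R => (s1 + t * (s2 - s1))%R).
assert (hsd : forall t, ex_derive s t) by (intros t; unfold s; auto_derive; trivial).
assert (hsc : forall t, continuous s t)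
  by (intros t; apply (ex_derive_continuous (K := R_AbsRing) (V := R_NormedModule)), hsd).
assert (hdom : forall t, (0 <= t <= 1)%R -> (0 < s t /\ 2 * atan (s t) < v)%R).
{ intros t ht. unfold s. split; [nra|].
  destruct (Rle_or_lt s1 s2) as [h|h].
  - apply Rle_lt_trans with (2 * atan s2)%R; [|exact hv2].
    apply Rmult_le_compat_l; [lra|].
    destruct (Rle_lt_or_eq_dec (s1 + t * (s2 - s1)) s2) as [l|l]; [nra| |].
    + now apply Rlt_le, atan_increasing.
    + rewrite l. lra.
  - apply Rle_lt_trans with (2 * atan s1)%R; [|exact hv1].
    apply Rmult_le_compat_l; [lra|].
    destruct (Rle_lt_or_eq_dec (s1 + t * (s2 - s1)) s1) as [l|l]; [nra| |].
    + now apply Rlt_le, atan_increasing.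
    + rewrite l. lra. }
assert (hxc : forall t, (0 <= t <= 1)%R -> continuous (fun u => level_abscissa v (s u)) t).
{ intros t ht. destruct (hdom t ht) as [h0 hv].
  apply (continuous_comp s (level_abscissa v)); [apply hsc|].
  apply (ex_derive_continuous (K := R_AbsRing) (V := R_NormedModule)).
  eexists. now apply is_derive_level_abscissa. }
exists (fun t => level_abscissa v (s t)), (fun t => (level_abscissa v (s t) * s t)%R).
assert (Es0 : s 0%R = s1) by (unfold s; ring).
assert (Es1 : s 1%R = s2) by (unfold s; ring).
rewrite Es0, Es1, E1, E2.
repeat split; try (unfold s1, s2; field; lra); trivial.
- now apply hxc.
- apply (continuous_mult (K := R_AbsRing) (fun t => level_abscissa v (s t)) s);
    [now apply hxc | apply hsc].
- destruct (hdom t H) as [h0 hv].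
  assert (L0 : locally t (fun u => (0 < s u)%R)).
  { exact (hsc t (fun q => (0 < q)%R) (open_gt 0%R _ h0)). }
  assert (Lv : locally t (fun u => (2 * atan (s u) < v)%R)).
  { assert (hc : continuous (fun u => 2 * atan (s u))%R t).
    { apply (ex_derive_continuous (K := R_AbsRing) (V := R_NormedModule)).
      unfold s. auto_derive. trivial. }
    exact (hc (fun q => (q < v)%R) (open_lt v _ hv)). }
  generalize (filter_and _ _ L0 Lv). apply filter_imp. intros u [hu0 huv]. split.
  + now apply level_abscissa_pos.
  + now apply level_abscissa_spec.
Qed.

Lemma exists_level_path (x1 y1 x2 y2 : R) :
  (0 < x1)%R -> (0 < x2)%R -> shear_im x1 y1 = shear_im x2 y2 ->
  exists x y : R -> R, x 0%R = x1 /\ y 0%R = y1 /\ x 1%R = x2 /\ y 1%R = y2 /\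
    level_path x y (shear_im x1 y1).
Proof.
intros hx1 hx2 hi.
destruct (Rtotal_order 0 (shear_im x1 y1)) as [h|[h|h]].
- apply level_path_pos; trivial;
    [apply (shear_im_sign x1) | apply (shear_im_sign x2)]; trivial; lra.
- assert (y1 = 0%R) by (apply (shear_im_eq_0 x1); trivial; lra).
  assert (y2 = 0%R) by (apply (shear_im_eq_0 x2); trivial; lra). subst y1 y2.
  exists (fun t => x1 + t * (x2 - x1))%R, (fun _ => 0%R).
  repeat split; try ring.
  + apply (ex_derive_continuous (K := R_AbsRing) (V := R_NormedModule)).
    auto_derive. trivial.
  + apply continuous_const.
  + assert (hc : continuous (fun u => x1 + u * (x2 - x1))%R t).
    { apply (ex_derive_continuous (K := R_AbsRing) (V := R_NormedModule)).
      auto_derive. trivial. }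
    assert (L : locally t (fun u => (0 < x1 + u * (x2 - x1))%R)).
    { apply (hc (fun q => (0 < q)%R)). apply (open_gt 0%R). nra. }
    revert L. apply filter_imp. intros u hu. split; [exact hu|].
    now rewrite !shear_im_0.
- destruct (level_path_pos x1 (- y1) x2 (- y2)) as (x & y & E1 & E2 & E3 & E4 & H);
    trivial.
  + apply (shear_im_sign x1); [exact hx1|]. rewrite shear_im_opp. lra.
  + apply (shear_im_sign x2); [exact hx2|]. rewrite shear_im_opp. lra.
  + rewrite !shear_im_opp. lra.
  + exists x, (fun t => - y t)%R. repeat split; trivial; try lra.
    * now apply H.
    * apply (continuous_opp (K := R_AbsRing) (V := R_NormedModule)). now apply H.
    * destruct (H t) as (_ & _ & L); [assumption|].
      revert L. apply filter_imp. intros u [hu hv]. split; [exact hu|].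
      rewrite shear_im_opp, hv, shear_im_opp. ring.
Qed.

(** * Wirtinger derivatives and normalization *)

Lemma dir_derive_eq (f h g : C -> C) (z v p q : C) :
  in_disk z -> (forall w, in_disk w -> f w = h w + Cconj (g w)) ->
  is_Cderive h z p -> is_Cderive g z q ->
  dir_derive f z v = p * v + Cconj (q * v).
Proof.
intros hz hf hp hq.
assert (L : locally 0%R (fun t : R => in_disk (z + t * v))).
{ destruct (disk_open z hz) as [d [hd Hd]].
  assert (hv := Cmod_ge_0 v).
  assert (hd' : (0 < d / (Cmod v + 1))%R) by (apply Rdiv_lt_0_compat; lra).
  exists (mkposreal _ hd'). intros t ht. apply Hd.
  change (Rabs (t - 0) < d / (Cmod v + 1))%R in ht. rewrite Rminus_0_r in ht.
  replace (z + t * v - z) with (t * v) by ring. rewrite Cmod_mult, Cmod_R.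
  apply Rlt_div_r in ht; [|lra]. assert (h0 := Rabs_pos t). nra. }
assert (hp' : is_Cderive h (z + 0%R * v) p)
  by (now rewrite Cmult_0_l, Cplus_0_r).
assert (hq' : is_Cderive g (z + 0%R * v) q)
  by (now rewrite Cmult_0_l, Cplus_0_r).
unfold dir_derive. apply injective_projections; simpl fst; simpl snd; apply is_derive_unique.
- apply (is_derive_ext_loc
    (fun t : R => (Re (h (z + t * v)%C) + Re (g (z + t * v)%C))%R)).
  + revert L. apply filter_imp. intros t ht. rewrite (hf _ ht).
    unfold Re. reflexivity.
  + exact (is_derive_plus (V := R_NormedModule) _ _ _ _ _
      (is_Cderive_line_Re _ _ _ _ _ hp') (is_Cderive_line_Re _ _ _ _ _ hq')).
- apply (is_derive_ext_loc
    (fun t : R => (Im (h (z + t * v)%C) + - Im (g (z + t * v)%C))%R)).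
  + revert L. apply filter_imp. intros t ht. rewrite (hf _ ht).
    unfold Im. reflexivity.
  + exact (is_derive_plus (V := R_NormedModule) _ _ _ _ _
      (is_Cderive_line_Im _ _ _ _ _ hp')
      (is_derive_opp (V := R_NormedModule) _ _ _ (is_Cderive_line_Im _ _ _ _ _ hq'))).
Qed.

Lemma wirtinger (f h g : C -> C) (z p q : C) :
  in_disk z -> (forall w, in_disk w -> f w = h w + Cconj (g w)) ->
  is_Cderive h z p -> is_Cderive g z q ->
  d_z f z = p /\ d_zbar f z = Cconj q.
Proof.
intros hz hf hp hq. unfold d_z, d_zbar.
rewrite !(dir_derive_eq f h g z _ p q hz hf hp hq), !Cmult_conj.
destruct p as [p1 p2], q as [q1 q2].
split; apply injective_projections; simpl; field.
Qed.

Lemma Cmod2_neg (p q : C) :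
  (Cmod p ^ 2 - Cmod q ^ 2)%R
  = (Re p ^ 2 + Im p ^ 2 - (Re q ^ 2 + Im q ^ 2))%R.
Proof. now rewrite !Cmod2_alt. Qed.

Lemma SH0_normalization_in_SH0 (f : C -> C) :
  univalent_harmonic f -> in_SH0 (SH0_normalization f).
Proof.
intros [(h & g & hh & hg & hf) [hsp [huni hf0]]].
assert (disk0 : in_disk 0) by (unfold in_disk; rewrite Cmod_0; lra).
assert (Hh := fun z hz => is_Cderive_of_analytic h z hh hz).
assert (Hg := fun z hz => is_Cderive_of_analytic g z hg hz).
assert (W := fun z hz => wirtinger f h g z _ _ hz hf (Hh z hz) (Hg z hz)).
set (A := d_z f 0). set (B := d_zbar f 0).
destruct (W 0 disk0) as [WA WB]. fold A in WA. fold B in WB.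
set (J := (Cmod A ^ 2 - Cmod B ^ 2)%R).
assert (hJ : (0 < J)%R) by exact (hsp 0 disk0).
assert (hJ0 : RtoC J <> 0) by (apply RtoC_neq; lra).
assert (hJC : RtoC J = A * Cconj A - B * Cconj B)
  by (unfold J; now rewrite RtoC_minus, !Cmod2_conj).
(* Substituting f = h + conj g in the normalization and sorting analytic from antianalytic terms
   gives h1 + conj g1. *)
set (h1 := fun z => / J * (Cconj A * h z - B * g z)).
set (g1 := fun z => / J * (A * g z - Cconj B * h z)).
assert (hf1 : forall z, in_disk z -> SH0_normalization f z = h1 z + Cconj (g1 z)).
{ intros z hz. unfold SH0_normalization. cbv zeta. fold A B J. rewrite (hf z hz).
  assert (EJ : Cconj (/ J) = / J).
  { rewrite <- RtoC_inv by lra. unfold Cconj, RtoC. simpl. f_equal. ring. }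
  unfold h1, g1.
  rewrite !Cmult_conj, EJ, Cminus_conj, !Cmult_conj, Cplus_conj, !Cconj_conj.
  field. exact hJ0. }
assert (Hh1 : forall z, in_disk z -> is_Cderive h1 z
  (/ J * (Cconj A * C_derive h z - B * C_derive g z))).
{ intros z hz. unfold h1. apply is_Cderive_scal.
  apply is_Cderive_minus; apply is_Cderive_scal; [now apply Hh | now apply Hg]. }
assert (Hg1 : forall z, in_disk z -> is_Cderive g1 z
  (/ J * (A * C_derive g z - Cconj B * C_derive h z))).
{ intros z hz. unfold g1. apply is_Cderive_scal.
  apply is_Cderive_minus; apply is_Cderive_scal; [now apply Hg | now apply Hh]. }
assert (W1 := fun z hz => wirtinger _ h1 g1 z _ _ hz hf1 (Hh1 z hz) (Hg1 z hz)).
repeat split.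
- exists h1, g1. repeat split; [| |exact hf1]; intros z hz; eexists;
    [now apply Hh1 | now apply Hg1].
- intros z hz. destruct (W1 z hz) as [-> ->]. rewrite Cmod_conj, !Cmod_mult.
  assert (hs := hsp z hz). destruct (W z hz) as [E1 E2]. rewrite E1, E2, Cmod_conj in hs.
  set (p := C_derive h z) in *. set (q := C_derive g z) in *.
  (* Jacobians multiply: the real-linear map before division by J has determinant |A|^2 - |B|^2 =
     J. *)
  replace ((Cmod (/ J) * Cmod (Cconj A * p - B * q)) ^ 2
    - (Cmod (/ J) * Cmod (A * q - Cconj B * p)) ^ 2)%R
    with (Cmod (/ J) ^ 2 * (J * (Cmod p ^ 2 - Cmod q ^ 2)))%R.
  + apply Rmult_lt_0_compat; [|now apply Rmult_lt_0_compat].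
    apply pow_lt, Cmod_gt_0. intros E. apply (Rlt_irrefl 0).
    assert (h0 : J * / J = 1) by now apply Cinv_r.
    rewrite E, Cmult_0_r in h0. apply RtoC_inj in h0. lra.
  + rewrite !Rpow_mult_distr, <- Rmult_minus_distr_l. f_equal.
    unfold J. rewrite !Cmod2_neg. generalize A B p q. intros [a1 a2] [b1 b2] [p1 p2] [q1 q2].
    unfold Re, Im. simpl. ring.
- intros z w hz hw E. apply huni; trivial.
  unfold SH0_normalization in E. cbv zeta in E. fold A B J in E.
  (* Taking moduli, |A| |X| = |B| |X| for the difference X, and |B| < |A| forces X = 0. *)
  assert (E' : Cconj A * (f z - f w) = B * Cconj (f z - f w)).
  { assert (E0 : Cconj A * f z - B * Cconj (f z) = Cconj A * f w - B * Cconj (f w)).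
    { transitivity (J * ((Cconj A * f z - B * Cconj (f z)) / J)); [now field|].
      rewrite E. now field. }
    rewrite Cminus_conj.
    replace (Cconj A * (f z - f w))
      with (Cconj A * f z - B * Cconj (f z) + B * Cconj (f z) - Cconj A * f w) by ring.
    rewrite E0. ring. }
  apply (f_equal Cmod) in E'. rewrite !Cmod_mult, !Cmod_conj in E'.
  assert (hX := Cmod_ge_0 (f z - f w)). assert (hA := Cmod_ge_0 A).
  assert (hB := Cmod_ge_0 B). unfold J in hJ.
  assert (hAB : (Cmod B < Cmod A)%R) by nra.
  assert (h0 : Cmod (f z - f w) = 0%R) by nra.
  apply Cmod_eq_0 in h0. replace (f z) with (f w + (f z - f w)) by ring.
  rewrite h0. ring.
- unfold SH0_normalization. cbv zeta. rewrite hf0.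
  replace (Cconj 0) with (RtoC 0); [unfold Cdiv; ring|].
  unfold Cconj, RtoC. simpl. f_equal. ring.
- destruct (W1 0 disk0) as [-> _]. rewrite <- WA.
  replace (C_derive g 0) with (Cconj B) by (rewrite WB; apply Cconj_conj).
  rewrite hJC. field. now rewrite <- hJC.
- destruct (W1 0 disk0) as [_ ->]. rewrite <- WA.
  replace (C_derive g 0) with (Cconj B) by (rewrite WB; apply Cconj_conj).
  replace (/ J * (A * Cconj B - Cconj B * A)) with (RtoC 0) by ring.
  unfold Cconj, RtoC. simpl. f_equal. ring.
Qed.

(** * A path criterion for connectedness *)

Lemma connected_of_paths (S : C -> Prop) :
  (forall p q, S p -> S q -> exists gamma : R -> C,
    gamma 0%R = p /\ gamma 1%R = q /\
    forall t : R, (0 <= t <= 1)%R ->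
      continuous (U := C_UniformSpace) gamma t /\ locally t (fun u => S (gamma u))) ->
  connected S.
Proof.
intros hpath U V hU hV hcov hdis [p [hp hpU]] [q [hq hqV]].
destruct (hpath p q hp hq) as (gamma & E0 & E1 & hg).
(* A separation would make this sign function locally constant along the path, hence continuous with
   both signs but no zero. Near points of V, that the path stays in S is what excludes U. *)
set (f := fun t : R => if excluded_middle_informative (U (gamma t)) then (-1)%R else 1%R).
assert (hcont : forall t, (0 <= t <= 1)%R -> continuity_pt f t).
{ intros t ht. destruct (hg t ht) as [hc hS].
  apply continuity_pt_filterlim.
  assert (hSt : S (gamma t)) by exact (locally_singleton _ _ hS).
  destruct (hcov _ hSt) as [hu|hv].
  - apply (continuous_ext_loc (T := R_UniformSpace) (U := R_UniformSpace) f
      (fun _ => (-1)%R) t); [|apply continuous_const].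
    refine (filter_imp (fun u => U (gamma u)) _ _ (hc U (hU _ hu))). intros u hu'. unfold f.
    destruct (excluded_middle_informative _); [reflexivity | contradiction].
  - apply (continuous_ext_loc (T := R_UniformSpace) (U := R_UniformSpace) f
      (fun _ => 1%R) t); [|apply continuous_const].
    refine (filter_imp (fun u => V (gamma u) /\ S (gamma u)) _ _
      (filter_and _ _ (hc V (hV _ hv)) hS)).
    intros u [hv' hs]. unfold f.
    destruct (excluded_middle_informative _) as [hu'|]; [|reflexivity].
    exfalso. exact (hdis _ hs (conj hu' hv')). }
assert (f0 : (f 0 < 0)%R).
{ unfold f. rewrite E0. destruct (excluded_middle_informative _); [lra | contradiction]. }
assert (f1 : (0 < f 1)%R).
{ unfold f. rewrite E1. destruct (excluded_middle_informative _) as [h|]; [|lra].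
  exfalso. exact (hdis _ hq (conj h hqV)). }
destruct (Ranalysis5.IVT_interv f 0 1 hcont Rlt_0_1 f0 f1) as [t [_ Et]].
unfold f in Et. destruct (excluded_middle_informative _); lra.
Qed.

(** * The convolution in the half-plane variable *)

Definition cayley (w : C) : C := (1 + w) / (1 - w).

Lemma cayley_neq (w : C) : in_disk w -> cayley w <> 0.
Proof.
intros hw E. apply (in_disk_plus_neq w hw).
assert (hm := in_disk_minus_neq w hw).
replace (1 + w) with (cayley w * (1 - w)) by (unfold cayley; field; exact hm).
rewrite E. ring.
Qed.

Lemma Cmod_lt_sqr (z w : C) :
  (Re z ^ 2 + Im z ^ 2 < Re w ^ 2 + Im w ^ 2)%R -> (Cmod z < Cmod w)%R.
Proof.
rewrite <- !Cmod2_alt. intros h. assert (h1 := Cmod_ge_0 z). assert (h2 := Cmod_ge_0 w).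
nra.
Qed.

Lemma cayley_Re_pos (w : C) : in_disk w -> (0 < Re (cayley w))%R.
Proof.
intros hw. assert (hne := in_disk_minus_neq w hw).
assert (h1 : (0 < (1 - Re w) ^ 2 + Im w ^ 2)%R).
{ apply Cmod_gt_0 in hne. assert (h := pow_lt _ 2 hne). rewrite Cmod2_alt in h.
  unfold Re, Im in *. simpl in *. lra. }
assert (h2 : (Re w ^ 2 + Im w ^ 2 < 1)%R).
{ rewrite <- Cmod2_alt. unfold in_disk in hw. assert (h := Cmod_ge_0 w). nra. }
replace (Re (cayley w))
  with ((1 - (Re w ^ 2 + Im w ^ 2)) / ((1 - Re w) ^ 2 + Im w ^ 2))%R.
- apply Rdiv_lt_0_compat; lra.
- destruct w as [x y]. unfold cayley, Re, Im in *. simpl in *. field.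
  repeat split; nra.
Qed.

Lemma cayley_onto (s : C) : (0 < Re s)%R -> exists w, in_disk w /\ cayley w = s.
Proof.
intros hs.
assert (hlt : (Cmod (s - 1) < Cmod (s + 1))%R).
{ apply Cmod_lt_sqr. destruct s as [x y]. unfold Re, Im in *. simpl in *. nra. }
assert (hne : s + 1 <> 0).
{ apply Cmod_gt_0. assert (h := Cmod_ge_0 (s - 1)). lra. }
exists ((s - 1) / (s + 1)). split.
- unfold in_disk. rewrite Cmod_div by exact hne. apply Rlt_div_l; [|lra].
  now apply Cmod_gt_0.
- unfold cayley. field. split; [exact hne|].
  replace (s + 1 - (s - 1)) with (RtoC 2) by (apply injective_projections; simpl; ring).
  apply RtoC_neq. lra.
Qed.

Lemma cayley_injective (w w' : C) :
  in_disk w -> in_disk w' -> cayley w = cayley w' -> w = w'.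
Proof.
assert (H : forall v, in_disk v -> v = (cayley v - 1) / (cayley v + 1)).
{ intros v hv. assert (hne := in_disk_minus_neq v hv). unfold cayley.
  field. split; [exact hne|].
  replace (1 + v + (1 - v)) with (RtoC 2) by (apply injective_projections; simpl; ring).
  apply RtoC_neq. lra. }
intros hw hw' E. rewrite (H w hw), (H w' hw'), E. reflexivity.
Qed.

Lemma is_Cderive_cayley (w : C) : in_disk w ->
  is_Cderive cayley w (2 / ((1 - w) * (1 - w))).
Proof.
intros hw. assert (hne := in_disk_minus_neq w hw).
eapply is_Cderive_eq.
- apply (is_Cderive_div (fun v => 1 + v) (fun v => 1 - v)); [exact hne| |].
  + apply is_Cderive_plus; [apply is_Cderive_const | apply is_Cderive_id].
  + apply is_Cderive_minus; [apply is_Cderive_const | apply is_Cderive_id].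
- cbv beta. field. exact hne.
Qed.

Definition shear_coef (a : R) : R := (dil_ratio a ^ 2 / 4)%R.

Lemma dil_ratio_bounds (a : R) : (0 <= a < 1)%R -> (0 < dil_ratio a <= 1)%R.
Proof.
intros ha. unfold dil_ratio. split.
- apply Rdiv_lt_0_compat; lra.
- apply Rle_div_l; lra.
Qed.

Lemma shear_coef_bounds (a : R) : (0 <= a < 1)%R -> (0 <= shear_coef a <= / 4)%R.
Proof.
intros ha. assert (h := dil_ratio_bounds a ha). unfold shear_coef. nra.
Qed.

Lemma RtoC_shear_coef (a : R) : RtoC (shear_coef a) = dil_ratio a * dil_ratio a / 4.
Proof.
unfold shear_coef. rewrite RtoC_div by lra. f_equal. rewrite <- RtoC_mult.
f_equal. ring.
Qed.

Definition sum_map (k s : C) : C := / 4 * (s + k * (s * s * s - / s) - 1).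

Lemma is_Cderive_sum_map (k s : C) : s <> 0 ->
  is_Cderive (sum_map k) s (/ 4 * (1 + k * (3 * (s * s) + / (s * s)))).
Proof.
intros hs. unfold sum_map. eapply is_Cderive_eq.
- apply is_Cderive_scal, is_Cderive_minus; [|apply is_Cderive_const].
  apply is_Cderive_plus; [apply is_Cderive_id|]. apply is_Cderive_scal, is_Cderive_minus.
  + apply (is_Cderive_mult (fun s => s * s) (fun s => s)); [|apply is_Cderive_id].
    apply is_Cderive_mult; apply is_Cderive_id.
  + now apply is_Cderive_inv.
- cbv beta. field. exact hs.
Qed.

Lemma Re_sum_map (k : R) (s : C) : (0 < Re s)%R ->
  Re (sum_map k s) = ((shear_re k (Re s) (Im s) - 1) / 4)%R.
Proof.
intros hs. destruct s as [x y]. unfold sum_map, shear_re, Re, Im in *. simpl in *.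
field. nra.
Qed.

(** Up to positive constants the two factors are the derivatives of H + G and H - G in s, so this
    real part is a positive multiple of |H'|^2 - |G'|^2. It equals 2 x times the expression in
    [jacobian_factor_pos]. *)
Lemma jacobian_pos (k : R) (s : C) : (0 <= k <= / 4)%R -> (0 < Re s)%R ->
  (0 < Re ((1 + k * (3 * (s * s) + / (s * s))) * Cconj (6 * s + 2 / s)))%R.
Proof.
intros hk hs. destruct s as [x y]. unfold Re in hs. simpl in hs.
assert (hr : (0 < x ^ 2 + y ^ 2)%R) by (assert (h := pow2_ge_0 y); nra).
assert (H := jacobian_factor_pos (x ^ 2 + y ^ 2) (/ (x ^ 2 + y ^ 2))
  ((x ^ 2 - 3 * y ^ 2) / (x ^ 2 + y ^ 2)) k hr (Rinv_0_lt_compat _ hr)).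
specialize (H ltac:(field; lra)).
specialize (H ltac:(apply Rlt_div_r; [lra | simpl; nra]) hk).
match type of H with (0 < ?e)%R => assert (H' : (0 < 2 * x * e)%R) end.
{ apply Rmult_lt_0_compat; [lra | exact H]. }
match type of H' with (0 < ?e)%R =>
  replace (Re _) with e; [exact H'|] end.
unfold Re, Cconj, Cdiv, Cinv, Cmult, Cplus, RtoC. simpl. field.
simpl in hr. split; nra.
Qed.

Lemma is_derive_shear_im (X Y : R -> R) (t dX dY : R) :
  (0 < X t)%R -> is_derive X t dX -> is_derive Y t dY ->
  is_derive (fun u => shear_im (X u) (Y u)) t
    (6 * (dX * Y t + X t * dY)
     + 2 * ((dY * X t - Y t * dX) / (X t ^ 2 + Y t ^ 2)))%R.
Proof.
intros hX HX HY. unfold shear_im. auto_derive.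
- repeat split; try (eexists; eassumption). lra.
- replace (Derive (fun x => X x) t) with dX by (symmetry; now apply is_derive_unique).
  replace (Derive (fun x => Y x) t) with dY by (symmetry; now apply is_derive_unique).
  field. split; [nra | lra].
Qed.

(** This is H - G. As h' + g' = 1 / (1 - w)^2, the derivatives drop out, while h - g stays implicit
    because its closed form contains a logarithm. *)
Definition conv_diff (a : R) (h g : C -> C) (w : C) : C :=
  / 2 * (h w - g w + dil_ratio a * (w / ((1 - w) * (1 - w)))).

Lemma is_Cderive_conv_diff (a : R) (h g : C -> C) (w : C) :
  (0 <= a < 1)%R -> in_disk w ->
  is_Cderive h w (dh a w) -> is_Cderive g w (dg a w) ->
  is_Cderive (conv_diff a h g) w
    (dil_ratio a / 16 * (6 * cayley w + 2 / cayley w) * (2 / ((1 - w) * (1 - w)))).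
Proof.
intros ha hw Hh Hg.
assert (hm := in_disk_minus_neq w hw). assert (hp := in_disk_plus_neq w hw).
assert (ha1 := one_plus_a_neq a ha).
unfold conv_diff. eapply is_Cderive_eq.
- apply is_Cderive_scal, is_Cderive_plus.
  + apply is_Cderive_minus; eassumption.
  + apply is_Cderive_scal.
    apply (is_Cderive_div (fun w => w) (fun w => (1 - w) * (1 - w))).
    * now apply Cmult_neq_0.
    * apply is_Cderive_id.
    * apply is_Cderive_mult;
        (apply is_Cderive_minus; [apply is_Cderive_const | apply is_Cderive_id]).
- cbv beta. unfold dg, dh, cayley. rewrite (RtoC_dil_ratio a ha). field.
  repeat split; assumption.
Qed.

(** Both sides vanish at w = 0, where s = 1, and have the same derivative along the radius to w.
    Since atan (y / x) is the argument of s on the half-plane, no complex logarithm is needed. *)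
Lemma Im_conv_diff (a : R) (h g : C -> C) :
  (0 <= a < 1)%R -> h 0 = 0 -> g 0 = 0 ->
  (forall z, in_disk z -> is_Cderive h z (dh a z) /\ is_Cderive g z (dg a z)) ->
  forall w, in_disk w ->
    Im (conv_diff a h g w) = (dil_ratio a / 16 * shear_im (Re (cayley w)) (Im (cayley w)))%R.
Proof.
intros ha h0 g0 hd w hw.
set (phi := fun t : R => (Im (conv_diff a h g (0 + t * w))
  - dil_ratio a / 16 * shear_im (Re (cayley (0 + t * w))) (Im (cayley (0 + t * w))))%R).
assert (E : phi 0%R = phi 1%R).
{ apply (eq_is_derive (V := R_NormedModule) phi); [|lra].
  intros t ht. assert (hu := in_disk_scal t w ht hw). destruct (hd _ hu) as [Hh Hg].
  assert (HD := is_Cderive_line_Im _ _ _ _ _ (is_Cderive_conv_diff a h g _ ha hu Hh Hg)).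
  assert (Hc := is_Cderive_cayley _ hu).
  assert (HS := is_derive_shear_im
    (fun s : R => Re (cayley (0 + s * w))) (fun s : R => Im (cayley (0 + s * w)))
    _ _ _ (cayley_Re_pos _ hu)
    (is_Cderive_line_Re _ _ _ _ _ Hc) (is_Cderive_line_Im _ _ _ _ _ Hc)).
  unfold phi. evar_last.
  - apply (is_derive_minus (V := R_NormedModule)); [exact HD|].
    apply is_derive_scal. exact HS.
  - assert (hs := cayley_Re_pos _ hu). cbv beta.
    (* Regrouping isolates the velocity of s along the radius, which is then generalized to an
       arbitrary p + i q. *)
    replace (dil_ratio a / 16 * (6 * cayley (0 + t * w) + 2 / cayley (0 + t * w))
        * (2 / ((1 - (0 + t * w)) * (1 - (0 + t * w)))) * w)
      with (dil_ratio a / 16 * (6 * cayley (0 + t * w) + 2 / cayley (0 + t * w))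
        * (2 / ((1 - (0 + t * w)) * (1 - (0 + t * w))) * w)) by ring.
    revert hs. generalize (2 / ((1 - (0 + t * w)) * (1 - (0 + t * w))) * w).
    generalize (cayley (0 + t * w)) (dil_ratio a).
    intros [x y] c [p q] hs. unfold Re in hs. simpl in hs.
    unfold minus, plus, opp, zero, Re, Im; simpl. field. nra. }
unfold phi in E. rewrite Cmult_0_l, Cmult_1_l, !Cplus_0_l in E.
unfold conv_diff at 1 in E. rewrite h0, g0 in E.
replace (cayley 0) with (RtoC 1) in E by (unfold cayley; field; apply RtoC_neq; lra).
change (Re 1) with 1%R in E. change (Im 1) with 0%R in E. rewrite shear_im_0 in E.
replace (/ 2 * (0 - 0 + dil_ratio a * (0 / ((1 - 0) * (1 - 0))))) with (RtoC 0) in E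
  by (unfold Cdiv; ring).
change (Im 0) with 0%R in E. lra.
Qed.

Lemma conv_h_plus_conv_g (a : R) (h g : C -> C) (w : C) :
  (0 <= a < 1)%R -> in_disk w -> h w + g w = w / (1 - w) ->
  conv_h a h w + conv_g a g w = sum_map (shear_coef a) (cayley w).
Proof.
intros ha hw E.
assert (hm := in_disk_minus_neq w hw). assert (hp := in_disk_plus_neq w hw).
assert (ha1 := one_plus_a_neq a ha).
unfold conv_h, conv_g.
replace (/ 2 * (h w + dil_ratio a * (w * dh a w)) + / 2 * (g w + - dil_ratio a * (w * dg a w)))
  with (/ 2 * ((h w + g w) + dil_ratio a * (w * (dh a w - dg a w)))) by ring.
rewrite E, RtoC_shear_coef, (RtoC_dil_ratio a ha). unfold sum_map, dg, dh, cayley.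
field. repeat split; assumption.
Qed.

Lemma conv_h_minus_conv_g (a : R) (h g : C -> C) (w : C) :
  in_disk w -> conv_h a h w - conv_g a g w = conv_diff a h g w.
Proof.
intros hw. assert (hm := in_disk_minus_neq w hw).
unfold conv_h, conv_g, conv_diff, dg. field. exact hm.
Qed.

(** The value H + conj G = Re (H + G) + i Im (H - G), written as a function of the half-plane
    variable. *)
Definition shear_value (a : R) (s : C) : C :=
  (((shear_re (shear_coef a) (Re s) (Im s) - 1) / 4)%R,
   (dil_ratio a / 16 * shear_im (Re s) (Im s))%R).

Lemma shear_value_injective (a : R) (s s' : C) :
  (0 <= a < 1)%R -> (0 < Re s)%R -> (0 < Re s')%R ->
  shear_value a s = shear_value a s' -> s = s'.
Proof.
intros ha hs hs' E. assert (hc := dil_ratio_bounds a ha).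
assert (Er := f_equal fst E). assert (Ei := f_equal snd E).
unfold shear_value in Er, Ei. simpl in Er, Ei.
destruct (shear_injective (shear_coef a) (Re s) (Im s) (Re s') (Im s')
  (shear_coef_bounds a ha) hs hs') as [Ex Ey].
- apply (Rmult_eq_reg_l (dil_ratio a / 16)); [exact Ei | lra].
- lra.
- now apply injective_projections.
Qed.

Definition sum_deriv (a : R) (w : C) : C :=
  2 / ((1 - w) * (1 - w)) * (/ 4 * (1 + shear_coef a *
    (3 * (cayley w * cayley w) + / (cayley w * cayley w)))).

Definition diff_deriv (a : R) (w : C) : C :=
  dil_ratio a / 16 * (6 * cayley w + 2 / cayley w) * (2 / ((1 - w) * (1 - w))).

(** H and G contain h' and g'. Writing them as half sum and half difference of [sum_map] and
    [conv_diff], whose derivatives are known, avoids second derivatives. *)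
Lemma is_Cderive_conv (a : R) (h g : C -> C) (w : C) :
  (0 <= a < 1)%R -> in_disk w ->
  (forall z, in_disk z -> h z + g z = z / (1 - z)) ->
  is_Cderive h w (dh a w) -> is_Cderive g w (dg a w) ->
  is_Cderive (conv_h a h) w (/ 2 * (sum_deriv a w + diff_deriv a w)) /\
  is_Cderive (conv_g a g) w (/ 2 * (sum_deriv a w - diff_deriv a w)).
Proof.
intros ha hw hg Hh Hg.
assert (HS : is_Cderive (fun v => sum_map (shear_coef a) (cayley v)) w (sum_deriv a w)).
{ apply (is_Cderive_comp (sum_map (shear_coef a)) cayley).
  - now apply is_Cderive_sum_map, cayley_neq.
  - now apply is_Cderive_cayley. }
assert (HD := is_Cderive_conv_diff a h g w ha hw Hh Hg).
split.
- apply (is_Cderive_ext_disk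
    (fun v => / 2 * (sum_map (shear_coef a) (cayley v) + conv_diff a h g v)));
    [exact hw | | now apply is_Cderive_scal, is_Cderive_plus].
  intros v hv. rewrite <- (conv_h_plus_conv_g a h g v ha hv (hg v hv)),
    <- (conv_h_minus_conv_g a h g v hv). field.
- apply (is_Cderive_ext_disk
    (fun v => / 2 * (sum_map (shear_coef a) (cayley v) - conv_diff a h g v)));
    [exact hw | | now apply is_Cderive_scal, is_Cderive_minus].
  intros v hv. rewrite <- (conv_h_plus_conv_g a h g v ha hv (hg v hv)),
    <- (conv_h_minus_conv_g a h g v hv). field.
Qed.

Lemma Cmod2_half_sum_diff (s d : C) :
  (Cmod (/ 2 * (s + d)) ^ 2 - Cmod (/ 2 * (s - d)) ^ 2 = Re (s * Cconj d))%R.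
Proof.
rewrite Cmod2_neg. destruct s as [s1 s2], d as [d1 d2]. unfold Re, Im. simpl. field.
Qed.

Lemma conv_jacobian_pos (a : R) (w : C) : (0 <= a < 1)%R -> in_disk w ->
  (0 < Re (sum_deriv a w * Cconj (diff_deriv a w)))%R.
Proof.
intros ha hw. unfold sum_deriv, diff_deriv.
assert (hm := in_disk_minus_neq w hw).
assert (H := jacobian_pos (shear_coef a) (cayley w) (shear_coef_bounds a ha)
  (cayley_Re_pos w hw)).
assert (hmu : 2 / ((1 - w) * (1 - w)) <> 0).
{ intros E. apply (RtoC_neq 2 0); [lra|].
  replace (RtoC 2) with (2 / ((1 - w) * (1 - w)) * ((1 - w) * (1 - w)))
    by (field; exact hm).
  rewrite E. ring. }
apply Cmod_gt_0 in hmu. apply (fun h => pow_lt _ 2 h) in hmu.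
rewrite Cmod2_alt in hmu.
assert (hc := dil_ratio_bounds a ha).
revert H hmu hc. generalize (2 / ((1 - w) * (1 - w))) (dil_ratio a).
generalize (1 + shear_coef a * (3 * (cayley w * cayley w) + / (cayley w * cayley w))).
generalize (6 * cayley w + 2 / cayley w). intros q p mu c H hmu hc.
(* The chain-rule factor [mu] is common to both derivatives and contributes only |mu|^2. *)
replace (Re _) with (c / 64 * (Re mu ^ 2 + Im mu ^ 2) * Re (p * Cconj q))%R.
- apply Rmult_lt_0_compat; [|exact H]. apply Rmult_lt_0_compat; [lra | exact hmu].
- destruct mu, p, q. unfold Re, Im. simpl. field.
Qed.

Lemma continuous_shear_re (k : R) (x y : R -> R) (t : R) :
  (0 < x t)%R -> continuous x t -> continuous y t ->
  continuous (fun u => shear_re k (x u) (y u)) t.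
Proof.
intros hx cx%continuity_pt_filterlim cy%continuity_pt_filterlim.
apply continuity_pt_filterlim. unfold shear_re.
assert (cp : forall (f : R -> R) n, continuity_pt f t ->
  continuity_pt (fun u => f u ^ n)%R t).
{ intros f n hf. apply (continuity_pt_comp f (fun v => v ^ n)%R); [exact hf|].
  apply derivable_continuous_pt, derivable_pt_pow. }
assert (hr : (x t ^ 2 + y t ^ 2 <> 0)%R) by (assert (h := pow2_ge_0 (y t)); nra).
apply continuity_pt_plus; [exact cx|]. apply continuity_pt_scal.
apply continuity_pt_minus; [apply continuity_pt_minus|].
- now apply cp.
- apply continuity_pt_mult; [now apply continuity_pt_scal | now apply cp].
- apply (continuity_pt_div x (fun u => x u ^ 2 + y u ^ 2)%R); [exact cx | | exact hr].
  apply continuity_pt_plus; now apply cp.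
Qed.

Lemma continuous_horizontal (q : C) (f : R -> R) (v t : R) :
  continuous f t -> continuous (U := C_UniformSpace) (fun u => q * (f u, v)) t.
Proof.
intros hf.
assert (c1 : continuous (fun u => Re q * f u - Im q * v)%R t).
{ apply (continuous_minus (V := R_NormedModule)); [|apply continuous_const].
  now apply (continuous_scal_r (V := R_NormedModule) (Re q) f). }
assert (c2 : continuous (fun u => Re q * v + Im q * f u)%R t).
{ apply (continuous_plus (V := R_NormedModule)); [apply continuous_const|].
  now apply (continuous_scal_r (V := R_NormedModule) (Im q) f). }
apply (filterlim_locally (U := C_UniformSpace)). intros eps.
generalize (filter_and _ _ (proj1 (filterlim_locally _ _) c1 eps)
  (proj1 (filterlim_locally _ _) c2 eps)).
apply filter_imp. intros u [h1 h2]. now split.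
Qed.

(* With F the convolution, d_z F 0 = 1 / (1+a)^2 and |d_zbar F 0| = a^2 / (1+a)^2,
   so F itself satisfies the normalization of S_H^0 exactly when a = 0; for
   the other a, membership in S_H^0 is that of the normalized map. *)
Theorem theorem2p4 (a alpha : R) (h g : C -> C)
  (ha : (0 <= a < 1)%R)
  (halpha : (0 <= alpha < 2 * PI)%R)
  (h_an : analytic_on_disk h)
  (g_an : analytic_on_disk g)
  (h0 : h 0 = 0)
  (g0 : g 0 = 0)
  (hg : forall z : C, in_disk z -> h z + g z = z / (1 - z))
  (dil : has_dilatation h g
           (fun z => (RtoC a - Cpow z 2) / (1 - RtoC a * Cpow z 2))) :
  let F := harmonic_convolution (h_slanted a alpha) (g_slanted a alpha) h g in
  univalent_harmonic F /\
  in_SH0 (SH0_normalization F) /\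
  (a = 0%R -> in_SH0 F) /\
  convex_in_direction (- alpha)%R F.
Proof.
intros F.
assert (hd := derivative_from_dilatation a h g ha h_an g_an hg dil).
set (e := cis alpha).
assert (hee : Cconj e * e = 1) by apply cis_conj_mult.
assert (he : Cmod e = 1%R) by apply Cmod_cis.
assert (hrot : forall z, in_disk z -> in_disk (e * z))
  by (intros z hz; now apply in_disk_cis).
set (H := fun z => Cconj e * conv_h a h (e * z)).
set (G := fun z => e * conv_g a g (e * z)).
assert (HF : forall z, in_disk z -> F z = H z + Cconj (G z))
  by exact (convolution_eq a alpha h g ha h0 hg hd).
(* Conjugation turns the factor e of G into conj e, so the same rotation comes out of both terms and
   horizontal slices become slices in the direction -alpha. *)
assert (Hval : forall z, in_disk z -> F z = Cconj e * shear_value a (cayley (e * z))).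
{ intros z hz. rewrite (HF z hz). unfold H, G. rewrite Cmult_conj.
  assert (hw := hrot z hz).
  assert (ES := conv_h_plus_conv_g a h g _ ha hw (hg _ hw)).
  assert (ED := conv_h_minus_conv_g a h g _ hw).
  assert (ER := Re_sum_map (shear_coef a) _ (cayley_Re_pos _ hw)).
  assert (EI := Im_conv_diff a h g ha h0 g0 hd _ hw).
  rewrite <- ES in ER. rewrite <- ED in EI. unfold shear_value. rewrite <- ER, <- EI.
  rewrite <- Cmult_plus_distr_l. reflexivity. }
assert (HdH : forall z, in_disk z -> is_Cderive H z
  (/ 2 * (sum_deriv a (e * z) + diff_deriv a (e * z)))).
{ intros z hz. assert (hw := hrot z hz). destruct (hd _ hw) as [Hh Hg].
  destruct (is_Cderive_conv a h g _ ha hw hg Hh Hg) as [Hch _].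
  eapply is_Cderive_eq.
  - apply is_Cderive_scal.
    apply (is_Cderive_comp (conv_h a h) (fun z => e * z)); [exact Hch|].
    apply is_Cderive_scal, is_Cderive_id.
  - cbv beta. rewrite Cmult_1_r, Cmult_assoc, hee. ring. }
assert (HdG : forall z, in_disk z -> is_Cderive G z
  (e * e * (/ 2 * (sum_deriv a (e * z) - diff_deriv a (e * z))))).
{ intros z hz. assert (hw := hrot z hz). destruct (hd _ hw) as [Hh Hg].
  destruct (is_Cderive_conv a h g _ ha hw hg Hh Hg) as [_ Hcg].
  eapply is_Cderive_eq.
  - apply is_Cderive_scal.
    apply (is_Cderive_comp (conv_g a g) (fun z => e * z)); [exact Hcg|].
    apply is_Cderive_scal, is_Cderive_id.
  - cbv beta. ring. }
assert (W := fun z hz => wirtinger F H G z _ _ hz HF (HdH z hz) (HdG z hz)).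
assert (disk0 : in_disk 0) by (unfold in_disk; rewrite Cmod_0; lra).
assert (Hshear : forall z z', in_disk z -> in_disk z' ->
  shear_value a (cayley (e * z)) = shear_value a (cayley (e * z')) -> z = z').
{ intros z z' hz hz' E. assert (hw := hrot z hz). assert (hw' := hrot z' hz').
  assert (Ec := shear_value_injective a _ _ ha (cayley_Re_pos _ hw)
    (cayley_Re_pos _ hw') E).
  apply (cayley_injective _ _ hw hw') in Ec.
  rewrite <- (Cmult_1_l z), <- (Cmult_1_l z'), <- hee, <- !Cmult_assoc.
  now rewrite Ec. }
assert (Hcancel : forall u v, Cconj e * u = Cconj e * v -> u = v).
{ intros u v E. rewrite <- (Cmult_1_l u), <- (Cmult_1_l v), <- hee.
  rewrite (Cmult_comm (Cconj e) e), <- !Cmult_assoc. now rewrite E. }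
assert (Huni : univalent F).
{ intros z z' hz hz' E. rewrite (Hval z hz), (Hval z' hz') in E.
  exact (Hshear z z' hz hz' (Hcancel _ _ E)). }
assert (HUH : univalent_harmonic F).
{ repeat split; [| |exact Huni|].
  - exists H, G. repeat split; [| |exact HF]; intros z hz; eexists;
      [now apply HdH | now apply HdG].
  - intros z hz. destruct (W z hz) as [-> ->].
    rewrite Cmod_conj, (Cmod_mult (e * e)), (Cmod_mult e e), he, !Rmult_1_l.
    rewrite Cmod2_half_sum_diff. now apply conv_jacobian_pos, hrot.
  - rewrite (HF 0 disk0). unfold H, G, conv_h, conv_g.
    rewrite Cmult_0_r, h0, g0, !Cmult_0_l, !Cmult_0_r, Cplus_0_l, !Cmult_0_r.
    apply injective_projections; simpl; ring. }
split; [exact HUH|]. split; [now apply SH0_normalization_in_SH0|]. split.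
- intros a0. split; [exact HUH|]. destruct (W 0 disk0) as [-> ->].
  assert (h4 : RtoC 4 <> 0) by (apply RtoC_neq; lra).
  assert (h16 : RtoC 16 <> 0) by (apply RtoC_neq; lra).
  (* For a = 0 the ratio c is 1 and both [sum_deriv] and [diff_deriv] equal 1 at the origin, so H' =
     1 and G' = 0 there. *)
  assert (Ec1 : RtoC (dil_ratio a) = 1).
  { unfold dil_ratio. rewrite a0. f_equal. field. }
  assert (Ec : cayley (e * 0) = 1)
    by (unfold cayley; rewrite Cmult_0_r; field; apply RtoC_neq; lra).
  assert (Es : sum_deriv a (e * 0) = 1).
  { unfold sum_deriv. rewrite Ec, RtoC_shear_coef, Ec1, Cmult_0_r. field. }
  assert (Ed : diff_deriv a (e * 0) = 1).
  { unfold diff_deriv. rewrite Ec, Ec1, Cmult_0_r. field. }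
  rewrite Es, Ed. split; [field; apply RtoC_neq; lra|].
  replace (e * e * (/ 2 * (1 - 1))) with (RtoC 0) by ring.
  apply injective_projections; simpl; ring.
- split; [exact Huni|]. intros p. apply connected_of_paths.
  intros q q' [[z [hz Ez]] [t Et]] [[z' [hz' Ez']] [t' Et']].
  rewrite cis_opp in Et, Et'. fold e in Et, Et'.
  assert (hw := hrot z hz). assert (hw' := hrot z' hz').
  rewrite Ez, (Hval z hz) in *. rewrite Ez', (Hval z' hz') in *. clear Ez Ez' q q'.
  assert (hc := dil_ratio_bounds a ha).
  set (s := cayley (e * z)) in *. set (s' := cayley (e * z')) in *.
  assert (hs : (0 < Re s)%R) by now apply cayley_Re_pos.
  assert (hs' : (0 < Re s')%R) by now apply cayley_Re_pos.
  (* Two image points on one line of direction -alpha differ by a real multiple of conj e, so their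
     shear values have the same imaginary part. *)
  assert (Ei : shear_im (Re s) (Im s) = shear_im (Re s') (Im s')).
  { assert (E : shear_value a s = shear_value a s' + RtoC (t - t')).
    { apply Hcancel. rewrite RtoC_minus, Cmult_plus_distr_l, Et'.
      rewrite Et. ring. }
    apply (f_equal snd) in E. unfold shear_value in E. simpl in E.
    apply (Rmult_eq_reg_l (dil_ratio a / 16)); [|lra]. rewrite Rplus_0_r in E. exact E. }
  destruct (exists_level_path _ _ _ _ hs hs' Ei) as (x & y & Ex0 & Ey0 & Ex1 & Ey1 & hp).
  exists (fun u => Cconj e * shear_value a (x u, y u)).
  rewrite Ex0, Ey0, Ex1, Ey1.
  split; [now destruct s|]. split; [now destruct s'|].
  intros u hu. destruct (hp u hu) as (hxc & hyc & hL).
  assert (hx0 : (0 < x u)%R) by exact (proj1 (locally_singleton _ _ hL)).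
  split.
  (* The level equation freezes the second coordinate, so only the continuity of [shear_re] along
     the path remains. *)
  + apply (continuous_ext_loc (T := R_UniformSpace) (U := C_UniformSpace) _
      (fun u => Cconj e * (((shear_re (shear_coef a) (x u) (y u) - 1) / 4)%R,
        (dil_ratio a / 16 * shear_im (Re s) (Im s))%R))).
    * revert hL. apply filter_imp. intros v [_ hv]. unfold shear_value.
      simpl. now rewrite hv.
    * apply (continuous_horizontal _ (fun u =>
        (shear_re (shear_coef a) (x u) (y u) - 1) / 4)%R).
      apply (continuous_mult (K := R_AbsRing)
        (fun u => shear_re (shear_coef a) (x u) (y u) - 1)%R (fun _ => (/ 4)%R));
        [|apply continuous_const].
      apply (continuous_minus (V := R_NormedModule)); [|apply continuous_const].
      now apply continuous_shear_re.
  + revert hL. apply filter_imp. intros v [hxv hv]. split.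
    * destruct (cayley_onto (x v, y v) hxv) as [w [hdw Ew]].
      assert (hdw' : in_disk (Cconj e * w))
        by (unfold in_disk; now rewrite Cmod_mult, Cmod_conj, he, Rmult_1_l).
      exists (Cconj e * w). split; [exact hdw'|].
      rewrite (Hval _ hdw'), Cmult_assoc, (Cmult_comm e), hee, Cmult_1_l, Ew.
      reflexivity.
    (* Along the path only the real part of the shear value moves, and its change is the shift of
       the line parameter. *)
    * exists (t + (Re (shear_value a (x v, y v)) - Re (shear_value a s)))%R.
      rewrite cis_opp. fold e.
      assert (E : shear_value a (x v, y v) = shear_value a s
        + RtoC (Re (shear_value a (x v, y v)) - Re (shear_value a s))).
      { apply injective_projections; unfold shear_value, Re, Im in *; simpl in *.
        - ring.
        - rewrite hv. ring. }
      rewrite E at 1. rewrite Cmult_plus_distr_l, Et, (RtoC_plus t). ring.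
Qed.
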